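(* Let $k \geq 2$ be an integer and let $\mathcal A = \{A_1,\ldots,A_n\}$ be a family of subsets of $\mathbb R^2$ satisfying: (i) $f_{k+1}(\mathcal A) = 0$ (no $k+2$ distinct members of $\mathcal A$ have a common point); (ii) for each $\sigma \subseteq [n]$ with $|\sigma| \in \{k,k+1\}$, the set $A_\sigma$ is empty, or a single point, or both open and path-connected. Then $f_k(\mathcal A) \leq c(k)\, f^{\mathrm{ind}}_{k-1}(\mathcal A)$, where $c(k) = \frac{4k+1}{4k^2-7k+1}$.
   Context: For a finite family $\mathcal A=\{A_1,\dots,A_n\}$ of sets and $\sigma\subseteq[n]=\{1,\dots,n\}$, write $A_\sigma=\bigcap_{i\in\sigma}A_i$. The nerve of $\mathcal A$ is $N(\mathcal A)=\{\sigma\subseteq[n]: A_\sigma\neq\emptyset\}$. For $k\ge 0$, $f_k(\mathcal A)=|\{\sigma\in N(\mathcal A): |\sigma|=k+1\}|$, and $f^{\mathrm{ind}}_k(\mathcal A)=|\{\tau\in N(\mathcal A): |\tau|=k+1 \text{ and there is } \sigma\in N(\mathcal A) \text{ with } \sigma\supset\tau,\ |\sigma|=k+2\}|$, i.e. the number of intersecting $(k+1)$-tuples contained in some intersecting $(k+2)$-tuple. *)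

(* Defs.v *)
From HB Require Import structures.
From mathcomp Require Import all_boot all_order all_algebra.
From mathcomp Require Import all_classical all_reals all_analysis.
Import Order.TTheory GRing.Theory Num.Theory.
Import numFieldNormedType.Exports.

Set Implicit Arguments.
Unset Strict Implicit.
Unset Printing Implicit Defensive.

Local Open Scope classical_set_scope.
Local Open Scope ring_scope.

(* By convention, the intersection over the empty index set is setT. *)
Definition face_cap (n : nat) (T : Type) (A : 'I_n -> set T)
    (s : {set 'I_n}) : set T :=
  \bigcap_(i in [set` s]) A i.

Definition nerve (n : nat) (T : Type) (A : 'I_n -> set T)
    : {set {set 'I_n}} :=
  [set s : {set 'I_n} | `[< face_cap A s !=set0 >]]%SET.

Definition f_num (n : nat) (T : Type) (A : 'I_n -> set T) (k : nat) : nat :=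
  #|[set s in nerve A | #|s| == k.+1]%SET|.

Definition f_ind (n : nat) (T : Type) (A : 'I_n -> set T) (k : nat) : nat :=
  #|[set t in nerve A | (#|t| == k.+1) &&
      [exists s in nerve A, (t \subset s) && (#|s| == k.+2)]]%SET|.

Definition path_connected (R : realType) (T : topologicalType) (A : set T)
    : Prop :=
  forall x y : T, A x -> A y ->
    exists g : R -> T,
      [/\ {within `[0, 1], continuous g}, g 0 = x, g 1 = y &
          forall t : R, 0 <= t <= 1 -> A (g t)].

Definition c_bound (R : realType) (k : nat) : R :=
  (4 * k%:R + 1) / (4 * k%:R ^+ 2 - 7 * k%:R + 1).

(* Main.v *)
Require Import Defs.
From HB Require Import structures.
From mathcomp Require Import all_boot all_order all_algebra.
From mathcomp Require Import all_classical all_reals all_analysis.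
From mathcomp Require Import zify lra.
Import Order.TTheory GRing.Theory Num.Theory.
Import numFieldNormedType.Exports.

Set Implicit Arguments.
Unset Strict Implicit.
Unset Printing Implicit Defensive.

(** The [k+1]-fold intersections that are single points are set aside: each of
    them accounts for [k] members of the [k]-fold count that nothing else uses.
    The other ones, [A_s], are pairwise disjoint open connected sets, and each
    open [A_t] with [#|t| = k] joins the [A_s] with [t \subset s] by a tree.
    Contracting every [A_s] to a vertex gives a planar graph with
    [(k+1) f_k - f^ind_{k-1}] edges.  A triangle of this graph lies inside one
    [(k+2)]-set [s :|: s'], and a planar graph on the at most [k+2] vertices
    contained in such a set has at most [3k] edges, so few faces can be
    triangles; counting faces then bounds the number of edges.

    Planarity is used in MacLane's algebraic form: the cycle space over the
    field with two elements has a generating family in which every edge occurs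
    at most twice.  This property is inherited by subgraphs and by contractions,
    and it holds for the square grid.  Compactness of the paths involved allows
    replacing the plane by a sufficiently fine grid. *)

Local Open Scope ring_scope.

(** * Planarity over the field with two elements *)

(** Trees are what makes the triangle argument work. Two vertices [s], [s'] joined inside [A_t]
    satisfy [s :&: s' = t], so an edge knows its [t]. A triangle whose edges share one [t] would be
    a cycle in the tree of [t]; any other triangle fits in a (k+2)-set. Trees do not cross, because
    distinct [A_t], [A_t'] meet only inside [A_s] with [s = t :|: t']: larger unions have no common
    point.

    Constants: with [F] faces, [X] edges, [Y] vertices and [T] triangular faces, Euler gives
    [X + 1 <= F + Y], and counting sides gives [4F <= 2X + T]. A class with [e <= 3k] edges has at
    most [(2e - 3)/3 <= (2k - 1)e/(3k)] triangles, whence [(4k + 1)X <= 12kY]. With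
    [X >= (k + 1)Y - j], where [j] is the number of trees, this becomes
    [(4k^2 - 7k + 1)Y <= (4k + 1)j].

    The topological obstacle is that paths in different [A_t] may meet arbitrarily often inside
    [A_s], and that a grid may disconnect [A_s]. Hence every lattice point shared by two trees must
    be joined, by a lattice walk inside some [A_s], to the base point of that [A_s]; this makes the
    contraction consistent. *)

Lemma F2P (x : 'F_2) : x = 0 \/ x = 1.
Proof. by case: x => [[|[|//]] ?]; [left | right]; apply: val_inj. Qed.

Lemma F2_addxx (x : 'F_2) : x + x = 0.
Proof. by case: (F2P x) => ->; apply: val_inj. Qed.

Lemma F2_natr_neq0 (n : nat) : ((n%:R : 'F_2) != 0) = odd n.
Proof.
elim: n => [|n IH] //; rewrite -(addn1 n) natrD oddD /= addbT -IH.
by case: (F2P n%:R) => ->.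
Qed.

Section ChainSpace.
Variable (E V : finType) (s t : E -> V).
Local Notation chain := {ffun E -> ('F_2)^o}.

Definition thru (e : E) : pred chain := fun b => b e != 0.

Definition supp (z : chain) : {set E} := [set e | z e != 0]%SET.

Definition bd (z : chain) : {ffun V -> ('F_2)^o} :=
  [ffun v => \sum_e z e * ((s e == v)%:R + (t e == v)%:R)].

Fact bd_is_linear : linear bd.
Proof.
move=> a y z; apply/ffunP => v; rewrite !ffunE scaler_sumr -big_split /=.
by apply: eq_bigr => e _; rewrite !ffunE mulrDl scalerAl.
Qed.
HB.instance Definition _ := GRing.isLinear.Build _ _ _ _ bd bd_is_linear.

Definition cyc (S : {set E}) : pred chain :=
  fun z => (supp z \subset S) && (bd z == 0).

(* MacLane's criterion: over [S] the graph is planar.  Only the span is required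
   to be the cycle space; [bs] may contain repetitions or the zero chain. *)
Definition two_basis (S : {set E}) : Prop :=
  exists2 bs : seq chain,
    forall e, (count (thru e) bs <= 2)%N &
    forall z, (z \in <<bs>>%VS) = cyc S z.

Lemma span_perm (xs ys : seq chain) : perm_eq xs ys -> <<xs>>%VS = <<ys>>%VS.
Proof. by move=> /perm_mem h; exact: eq_span. Qed.

Lemma span_coord0 (X : seq chain) e :
  (forall b : chain, b \in X -> b e = 0) ->
  forall z : chain, z \in <<X>>%VS -> z e = 0.
Proof.
elim: X => [|b X IH] X0 z; first by rewrite span_nil memv0 => /eqP ->; rewrite ffunE.
rewrite span_cons => /memv_addP[_ /vlineP[a ->] [v vX ->]].
rewrite !ffunE X0 ?mem_head // IH ?scaler0 ?addr0 // => c cX.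
by apply: X0; rewrite inE cX orbT.
Qed.

(** At most two generators pass through [e]. A single one is dropped; two are replaced by their sum,
    which merges the faces on either side of [e]. The others avoid [e] already, and no multiplicity
    grows. *)
Lemma two_basis_del (S : {set E}) (e : E) : two_basis S -> two_basis (S :\ e)%SET.
Proof.
case=> bs cnt sp.
set p := thru e.
have pe : perm_eq ([seq b <- bs | p b] ++ [seq b <- bs | predC p b]) bs.
  by rewrite perm_filterC.
have cycD z : cyc (S :\ e)%SET z = cyc S z && (z e == 0).
  by rewrite /cyc finset.subsetD1 inE negbK andbAC.
have rest0 z : z \in <<[seq b <- bs | predC p b]>>%VS -> z e = 0.
  by apply: span_coord0 => b; rewrite mem_filter /= negbK => /andP[/eqP].
have sp' z : cyc S z = (z \in (<<[seq b <- bs | p b]>> + <<[seq b <- bs | predC p b]>>)%VS).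
  by rewrite -sp -span_cat (span_perm pe).
have cnt' e' : (count (thru e') [seq b <- bs | p b] +
    count (thru e') [seq b <- bs | predC p b] <= 2)%N.
  by rewrite -count_cat (seq.permP pe).
have : (size [seq b <- bs | p b] <= 2)%N by rewrite size_filter; exact: cnt.
have : all p [seq b <- bs | p b] by rewrite filter_all.
move: sp' cnt'; move: [seq b <- bs | p b] => A.
move: rest0; move: [seq b <- bs | predC p b] => B rest0.
have scale1 (a : 'F_2) : a *: (1 : ('F_2)^o) = a by exact: mulr1.
have pE b : p b -> b e = 1.
  by rewrite /p /thru; case: (F2P (b e)) => ->.
case: A => [|b1 [|b2 [|//]]] sp' cnt' /= pA _.
- exists B => // z; rewrite cycD sp' span_nil add0v.
  by apply/idP/andP => [h|[]//]; split; rewrite ?rest0.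
- exists B.
    by move=> e'; apply: leq_trans (cnt' e'); rewrite leq_addl.
  move=> z; rewrite cycD sp'; move: pA; rewrite andbT => /pE b1e.
  apply/idP/andP => [h|[/memv_addP[u]]].
    split; last by rewrite rest0.
    by rewrite -[z]add0r; apply: memv_add => //; rewrite mem0v.
  rewrite span_seq1 => /vlineP[a ->] [v vB ->].
  rewrite !ffunE b1e (rest0 _ vB) addr0 => /eqP.
  by rewrite scale1 => ->; rewrite scale0r add0r.
- exists (b1 + b2 :: B).
    move=> e'; apply: leq_trans (cnt' e') => /=; rewrite addn0 leq_add2r.
    rewrite /thru ffunE; case: (eqVneq (b1 e') 0) => [->|_] /=; first by rewrite add0r.
    by case: (_ != 0).
  move=> z; rewrite cycD sp'; move: pA => /and3P[/pE b1e /pE b2e _].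
  rewrite !span_cons span_nil addv0.
  apply/idP/andP => [/memv_addP[u /vlineP[a ->] [v vB ->]]|[]].
    split.
      apply: memv_add => //; rewrite scalerDr; apply: memv_add; exact: memvZ (memv_line _).
    rewrite !ffunE b1e b2e (rest0 _ vB) addr0.
    by rewrite F2_addxx scaler0.
  case/memv_addP=> u /memv_addP[u1 /vlineP[a1 ->] [u2 /vlineP[a2 ->] ->]] [v vB ->].
  rewrite !ffunE b1e b2e (rest0 _ vB) addr0 !scale1 => /eqP a12.
  apply: memv_add => //; apply/vlineP; exists a1; rewrite scalerDr.
  suff -> : a2 = a1 by [].
  by apply: (addrI a1); rewrite a12 F2_addxx.
Qed.

Lemma two_basis_sub (S S' : {set E}) : S' \subset S -> two_basis S -> two_basis S'.
Proof.
move=> sub P.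
have -> : S' = (S :\: (S :\: S'))%SET by rewrite finset.setDDr finset.setDv finset.set0U; apply/esym/finset.setIidPr.
move: (S :\: S')%SET {sub} => D; have [m] := ubnP #|D|; elim: m D => // m IH D.
have [->|[e eD]] := set_0Vmem D; first by rewrite finset.setD0.
rewrite (cardsD1 e) eD ltnS => /IH h.
by rewrite -(finset.setD1K eD) finset.setUC -finset.setDDl; exact: two_basis_del.
Qed.

End ChainSpace.

(** * Face counting and Euler's inequality *)

Section Counting.
Variable (E V : finType) (s t : E -> V).
Local Notation chain := {ffun E -> ('F_2)^o}.

(** A dependent generator can be discarded without raising any multiplicity. Freeness makes every
    face nonzero, so that the girth bounds its size, and makes the sum of all faces nonzero. *)
Lemma free_basis (bs : seq chain) :
  exists bs' : seq chain, [/\ free bs', <<bs'>>%VS = <<bs>>%VS &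
    forall e, (count (thru e) bs' <= count (thru e) bs)%N].
Proof.
elim: bs => [|b bs [bs' [fr sp cnt]]]; first by exists [::]; rewrite nil_free.
have [bin|bnin] := boolP (b \in <<bs>>%VS).
  exists bs'; split=> // [|e]; last by apply: leq_trans (cnt e) _; rewrite /= leq_addl.
  by rewrite sp span_cons; apply/esym/addv_idPr; rewrite -memvE.
exists (b :: bs'); split=> [||e] /=.
- by rewrite free_cons sp bnin.
- by rewrite !span_cons sp.
- by rewrite leq_add2l.
Qed.

Lemma sum_size_supp (bs : seq chain) (S : {set E}) :
  (forall b : chain, b \in bs -> supp b \subset S) ->
  (\sum_(b <- bs) #|supp b| = \sum_(e in S) count (thru e) bs)%N.
Proof.
elim: bs => [|b bs IH] subS; first by rewrite big_nil big1.
rewrite big_cons IH => [|c cbs]; last by apply: subS; rewrite inE cbs orbT.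
rewrite big_split /=; congr addn.
rewrite -sum1_card big_mkcond [RHS]big_mkcond /=; apply: eq_bigr => e _.
have := fintype.subsetP (subS b (mem_head _ _)) e; rewrite inE /thru.
by case: (b e != 0) => [->|_] //; case: (e \in S).
Qed.

(* The sum of all faces is a nonzero cycle, and each of its edges lies on
   only one face. *)
Lemma face_count (S : {set E}) (bs : seq chain) :
  free bs -> bs != [::] ->
  (forall b : chain, b \in bs -> cyc s t S b) ->
  (forall e, count (thru e) bs <= 2)%N ->
  (forall z : chain, cyc s t S z -> z != 0 -> (3 <= #|supp z|)%N) ->
  (\sum_(b <- bs) #|supp b| + 3 <= 2 * #|S|)%N.
Proof.
move=> fr nn cy cnt girth.
have subS (b : chain) : b \in bs -> supp b \subset S by move=> /cy /andP[].
rewrite (sum_size_supp subS).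
pose w : chain := \sum_(b <- bs) b.
have bd0 (r : seq chain) : (forall b : chain, b \in r -> bd s t b = 0) ->
    bd s t (\sum_(b <- r) b) = 0.
  by move=> r0; rewrite linear_sum big_seq big1.
have wE e : w e = (count (thru e) bs)%:R.
  rewrite /w sum_ffunE; elim: (bs) => [|b r IH]; rewrite ?big_nil //.
  rewrite big_cons IH /= natrD /thru; congr (_ + _).
  by case: (F2P (b e)) => ->.
have w0 : w != 0.
  move: fr nn; rewrite /w; case: (bs) => [//|b r]; rewrite free_cons => /andP[bn _] _.
  rewrite big_cons addr_eq0; apply: contra bn => /eqP ->.
  by rewrite memvN big_seq; apply: memv_suml => c; exact: memv_span.
have wS : supp w \subset S.
  apply/fintype.subsetP => e; rewrite inE wE F2_natr_neq0 => /odd_gt0.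
  rewrite -has_count => /hasP[b bbs be].
  by apply: (fintype.subsetP (subS b bbs)); rewrite inE.
have cw : cyc s t S w.
  by rewrite /cyc wS bd0 ?eqxx // => b /cy /andP[_ /eqP].
apply: leq_trans (leq_add (leqnn _) (girth w cw w0)) _.
have -> : (#|supp w| = \sum_(e in S) (w e != 0%R))%N.
  rewrite -sum1_card big_mkcond [RHS]big_mkcond /=; apply: eq_bigr => e _.
  have := fintype.subsetP wS e; rewrite inE.
  by case: (w e != 0) => [->|_] //; case: (e \in S).
(* Edge by edge: a multiplicity of at most 2, plus 1 if it is odd, is still at most 2. *)
rewrite -big_split /= mulnC -sum_nat_const; apply: leq_sum => e _.
rewrite wE F2_natr_neq0; move: (cnt e).
by case: (count _ _) => [|[|[|]]].
Qed.

(** One half of Euler's formula, as rank and nullity of the boundary map: its kernel over [S] has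
    dimension at most [size bs], and its image lies in the even chains on [W], spanned by the
    [#|W| - 1] chains [dv v] with [v != v0]. *)
Lemma size_two_basis (S : {set E}) (W : {set V}) (bs : seq chain) (v0 : V) :
  (forall z : chain, (z \in <<bs>>%VS) = cyc s t S z) ->
  (forall e, e \in S -> (s e \in W) && (t e \in W)) -> v0 \in W ->
  (#|S| + 1 <= size bs + #|W|)%N.
Proof.
move=> sp inW v0W.
pose de (e : E) : chain := [ffun e' => (e' == e)%:R].
pose dv (v : V) : {ffun V -> ('F_2)^o} := [ffun v' => (v == v')%:R + (v0 == v')%:R].
pose f : 'Hom(chain, {ffun V -> ('F_2)^o}) := linfun (bd s t).
pose X := [seq de e | e <- enum S].
have suppX z : z \in <<X>>%VS -> supp z \subset S.
  move=> zX; apply/fintype.subsetP => e; rewrite inE; apply: contraR => eS.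
  apply/eqP; apply: span_coord0 zX => b /mapP[e']; rewrite mem_enum => e'S ->.
  by rewrite ffunE; case: eqP eS => // ->; rewrite e'S.
have frX : free X.
  rewrite /X; elim: (enum S) (enum_uniq S) => [|e es IH] /=; first by rewrite nil_free.
  case/andP=> ees /IH fr; rewrite free_cons fr andbT; apply/negP => h.
  have := @span_coord0 E [seq de i | i <- es] e.
  move=> /(_ _ _ h); rewrite !ffunE eqxx => h1.
  suff // : (1 : 'F_2) = 0 by [].
  apply: h1 => b /mapP[e' e'es ->]; rewrite ffunE.
  by case: eqP ees => // ->; rewrite e'es.
have dimX : \dim <<X>> = #|S|.
  by move: frX; rewrite /free => /eqP ->; rewrite size_map cardE.
have dimK : (\dim (<<X>> :&: lker f) <= size bs)%N.
  apply: leq_trans (dim_span bs); apply: dimvS; apply/subvP => z.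
  rewrite memv_cap memv_ker lfunE /= sp /cyc => /andP[/suppX -> h].
  exact: h.
pose Y := [seq dv v | v <- enum (W :\ v0)%SET].
have dimI : (\dim (f @: <<X>>) <= #|(W :\ v0)%SET|)%N.
  have -> : #|(W :\ v0)%SET| = size Y by rewrite size_map cardE.
  apply: leq_trans (dim_span Y); apply: dimvS.
  have dvY v : v \in W -> dv v \in <<Y>>%VS.
    move=> vW; have [->|vv0] := eqVneq v v0.
      suff -> : dv v0 = 0 by rewrite mem0v.
      by apply/ffunP => v'; rewrite !ffunE F2_addxx.
    by apply/memv_span/map_f; rewrite mem_enum !inE vv0.
  rewrite limg_span; apply/span_subvP => _ /mapP[_ /mapP[e eS ->] ->].
  rewrite lfunE /=.
  suff -> : bd s t (de e) = dv (s e) + dv (t e).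
    by rewrite mem_enum in eS; have /andP[? ?] := inW e eS; apply: memvD; apply: dvY.
  apply/ffunP => v; rewrite !ffunE (bigD1 e) //= big1 => [|e' ne].
    rewrite !ffunE eqxx mul1r addr0 addrACA F2_addxx addr0 //.
  by rewrite ffunE (negbTE ne) mul0r.
have := limg_ker_dim f <<X>>; rewrite dimX => <-.
by rewrite (cardsD1 v0 W) v0W add1n addn1 addnS ltnS leq_add.
Qed.

End Counting.

(** * The edge bound *)

Lemma parity_bd (E V : finType) (s t : E -> V) (z : {ffun E -> ('F_2)^o}) v :
  (bd s t z v == 0) = ~~ odd (\sum_(e in supp z) ((s e == v) + (t e == v)))%N.
Proof.
rewrite -F2_natr_neq0 negbK natr_sum ffunE (bigID (mem (supp z))) /=.
rewrite [X in _ + X]big1 => [|e]; last by rewrite inE negbK => /eqP ->; rewrite mul0r.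
rewrite addr0; congr (_ == _); apply: eq_bigr => e; rewrite inE natrD.
by case: (F2P (z e)) => ->; rewrite ?mul1r.
Qed.

Lemma sum_set2 (T : finType) (F : T -> nat) (a b : T) :
  a != b -> (\sum_(i in [set a; b]%SET) F i = F a + F b)%N.
Proof.
move=> ab; rewrite (bigD1 a) ?inE ?eqxx //= (big_pred1 b) // => i.
by rewrite !inE; case: eqVneq => [->|]; rewrite ?andbT ?andbF //= (negbTE ab).
Qed.

Section SetTriangle.
Variable (T : finType) (k : nat).

(** Either [C] lies in [A :|: B], and cardinalities force the equality, or [C] has a point [w]
    outside, and then all three pairwise meets equal [C :\ w], which is excluded. *)
Lemma triangle_cup (A B C : {set T}) :
  #|A| = k.+1 -> #|B| = k.+1 -> #|C| = k.+1 ->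
  #|A :&: B| = k -> #|A :&: C| = k -> #|B :&: C| = k ->
  ~ (A :&: B = A :&: C /\ A :&: B = B :&: C) -> A :|: B = A :|: C.
Proof.
move=> cA cB cC cAB cAC cBC ne.
have [sub|/fintype.subsetPn[w wC wAB]] := boolP (C \subset A :|: B).
  apply/esym/eqP; rewrite eqEcard finset.subUset finset.subsetUl sub /=.
  by rewrite !cardsU cA cB cC cAB cAC.
case: ne; rewrite !inE negb_or in wAB; have /andP[wA wB] := wAB.
have cCw : #|C :\ w| = k by move: cC; rewrite (cardsD1 w) wC => -[].
have e1 : A :&: C = C :\ w.
  apply/eqP; rewrite eqEcard cAC cCw leqnn andbT finset.subsetD1 finset.subsetIr.
  by rewrite inE (negbTE wA).
have e2 : B :&: C = C :\ w.
  apply/eqP; rewrite eqEcard cBC cCw leqnn andbT finset.subsetD1 finset.subsetIr.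
  by rewrite inE (negbTE wB).
have e3 : A :&: B = C :\ w.
  apply/esym/eqP; rewrite eqEcard cAB cCw leqnn andbT finset.subsetI.
  by rewrite -{1}e1 -e2 !finset.subsetIl.
by rewrite e1 e2 e3.
Qed.

End SetTriangle.

Section EdgeBound.
Variables (n k : nat) (E V : finType) (s t : E -> V) (S : {set E}) (W : {set V}).
Variable sg : V -> {set 'I_n}.
Local Notation chain := {ffun E -> ('F_2)^o}.
Local Notation ends e := [set s e; t e]%SET.

Hypothesis k_ge2 : (2 <= k)%N.
Hypothesis inW : forall e, e \in S -> (s e \in W) && (t e \in W).
Hypothesis sg_inj : {in W &, injective sg}.
Hypothesis sg_size : forall v, v \in W -> #|sg v| = k.+1.
Hypothesis sg_meet : forall e, e \in S -> #|sg (s e) :&: sg (t e)| = k.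
Hypothesis simple : {in S &, forall e e', ends e = ends e' -> e = e'}.
(** In the application this expresses acyclicity: equal meets put the three edges in one tree. *)
Hypothesis no_sunflower : forall a b c e1 e2 e3,
  a != b -> a != c -> b != c -> e1 \in S -> e2 \in S -> e3 \in S ->
  ends e1 = [set a; b]%SET -> ends e2 = [set a; c]%SET -> ends e3 = [set b; c]%SET ->
  ~ (sg a :&: sg b = sg a :&: sg c /\ sg a :&: sg b = sg b :&: sg c).
Hypothesis planar : two_basis s t S.

Let loopless e : e \in S -> s e != t e.
Proof.
move=> eS; have /andP[sW tW] := inW eS; apply/eqP => h; have := sg_meet eS.
by rewrite h finset.setIid sg_size // => /eqP; rewrite -addn1 -[X in _ == X]addn0 eqn_add2l.
Qed.

Let parity (z : chain) v : cyc s t S z -> ~~ odd (\sum_(e in supp z) (v \in ends e))%N.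
Proof.
case/andP=> zS /eqP/ffunP/(_ v)/eqP; rewrite [X in _ == X]ffunE parity_bd.
suff -> : (\sum_(e in supp z) ((s e == v) + (t e == v)) = \sum_(e in supp z) (v \in ends e))%N by [].
apply: eq_bigr => e /(fintype.subsetP zS)/loopless st; rewrite !inE (eq_sym v (s e)) (eq_sym v (t e)).
by have [<-|_] := eqVneq (s e) v; rewrite // eq_sym (negbTE st).
Qed.

Let ends_card e : e \in S -> #|ends e| = 2%N.
Proof. by move=> eS; rewrite cards2 loopless. Qed.

(** A support of one edge would be a loop, one of two edges a pair of parallel edges. *)
Let girth (z : chain) : cyc s t S z -> z != 0 -> (3 <= #|supp z|)%N.
Proof.
move=> cz z0; have /andP[zS _] := cz.
have := @parity z ^~ cz.
case E0 : #|supp z| => [|[|[|//]]] par.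
- case/negP: z0; apply/eqP/ffunP => e; rewrite ffunE.
  by have := finset.in_set0 e; rewrite -(cards0_eq E0) inE => /negbFE/eqP ->.
- have /cards1P[e ez] : #|supp z| == 1%N by rewrite E0.
  have eS : e \in S by rewrite (fintype.subsetP zS) // ez inE.
  by have := par (s e); rewrite ez big_set1 !inE eqxx.
- have /cards2P[e1 [e2 [ne ez]]] : #|supp z| == 2%N by rewrite E0.
  have e1S : e1 \in S by rewrite (fintype.subsetP zS) // ez !inE eqxx.
  have e2S : e2 \in S by rewrite (fintype.subsetP zS) // ez !inE eqxx orbT.
  case/eqP: (ne); apply: simple => //; apply/eqP.
  rewrite eqEcard !ends_card // leqnn andbT; apply/fintype.subsetP => v ve.
  by have := par v; rewrite ez sum_set2 //= ve; case: (v \in ends e2).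
Qed.

(** The (k+2)-set spanned by an edge. It sorts the edges into classes, and a triangle never leaves
    its class. *)
Let cl e : {set 'I_n} := \bigcup_(v in ends e) sg v.

Let clE e a b : ends e = [set a; b]%SET -> cl e = sg a :|: sg b.
Proof. by move=> h; rewrite /cl h finset.bigcup_setU !big_set1. Qed.

Let cl_card e : e \in S -> #|cl e| = k.+2.
Proof.
move=> eS; have /andP[sW tW] := inW eS.
by rewrite (@clE e (s e) (t e)) // cardsU sg_meet // !sg_size //; lia.
Qed.

Let meet_ends e a b : e \in S -> ends e = [set a; b]%SET ->
  [/\ a \in W, b \in W, a != b & #|sg a :&: sg b| = k].
Proof.
move=> eS h; have /andP[sW tW] := inW eS; have st := loopless eS.
have inWe v : v \in ends e -> v \in W by rewrite !inE => /orP[] /eqP ->.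
have ab : a != b by have := ends_card eS; rewrite h cards2; case: (a != b).
split=> //; try by apply: inWe; rewrite h !inE eqxx ?orbT.
have : sg a :&: sg b = sg (s e) :&: sg (t e).
  have : a \in ends e by rewrite h !inE eqxx.
  have : b \in ends e by rewrite h !inE eqxx orbT.
  rewrite !inE => /orP[] /eqP be /orP[] /eqP ae; rewrite ?be ?ae in ab *;
    by rewrite ?eqxx // in ab; rewrite finset.setIC.
by move=> ->; exact: sg_meet.
Qed.

Let tri_aux a b c e1 e2 e3 : e1 \in S -> e2 \in S -> e3 \in S ->
  ends e1 = [set a; b]%SET -> ends e2 = [set a; c]%SET -> ends e3 = [set b; c]%SET ->
  cl e1 = cl e2 /\ cl e1 = cl e3.
Proof.
move=> e1S e2S e3S h1 h2 h3.
have [aW bW ab mab] := meet_ends e1S h1.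
have [_ cW ac mac] := meet_ends e2S h2.
have [_ _ bc mbc] := meet_ends e3S h3.
have ns := no_sunflower ab ac bc e1S e2S e3S h1 h2 h3.
have ca := sg_size aW; have cb := sg_size bW; have cc := sg_size cW.
rewrite (clE h1) (clE h2) (clE h3); split.
  exact: (triangle_cup ca cb cc).
rewrite finset.setUC; apply: (triangle_cup cb ca cc) => //; first by rewrite finset.setIC.
by rewrite (finset.setIC (sg b) (sg a)) => -[? ?]; apply: ns.
Qed.

(** A cycle of three edges has to be recognized as a triangle on three vertices before [tri_aux]
    applies; parity of the degrees suffices for this. *)
Let tri_cl (z : chain) : cyc s t S z -> #|supp z| = 3 ->
  {in supp z &, forall e e', cl e = cl e'}.
Proof.
move=> cz c3; have /andP[zS _] := cz; have par := @parity z ^~ cz.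
have [e1 e1z] : exists e, e \in supp z by apply/card_gt0P; rewrite c3.
have c2 : #|supp z :\ e1| == 2%N by move: c3; rewrite (cardsD1 e1) e1z add1n => -[] ->.
move/cards2P: c2 => [e2 [e3 [e23 ez]]].
have parE v : ~~ odd ((v \in ends e1) + (v \in ends e2) + (v \in ends e3)).
  by have := par v; rewrite (big_setD1 e1) //= ez sum_set2 //= addnA.
have m2 : e2 \in supp z :\ e1 by rewrite ez !inE eqxx.
have m3 : e3 \in supp z :\ e1 by rewrite ez !inE eqxx orbT.
move: m2 m3; rewrite !finset.in_setD1 => /andP[e21 m2] /andP[e31 m3].
have inS e : e \in supp z -> e \in S by exact: (fintype.subsetP zS).
have suff1 e e' : e \in S -> e' \in S -> e != e' -> ends e \subset ends e' -> False.
  move=> eS eS' ne sub; case/eqP: ne; apply: simple => //.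
  by apply/eqP; rewrite eqEcard sub !ends_card.
(* Here [f] meets [e1] at its source and [g] meets it at its target. Parity makes the remaining ends
   of [f] and [g] coincide. *)
have key f g : e1 \in S -> f \in S -> g \in S -> f != e1 -> g != e1 -> f != g ->
    (forall v, ~~ odd ((v \in ends e1) + (v \in ends f) + (v \in ends g))) ->
    s e1 \in ends f -> cl e1 = cl f /\ cl e1 = cl g.
  move=> e1S fS gS f1 g1 fg pr af.
  have ag : s e1 \notin ends g.
    by have := pr (s e1); rewrite af !inE eqxx /=; case: (_ || _).
  have bf : t e1 \notin ends f.
    apply/negP => bf; apply: (suff1 e1 f) => //; first by rewrite eq_sym.
    by rewrite finset.subUset !finset.sub1set af bf.
  have bg : t e1 \in ends g.
    have te : t e1 \in ends e1 by rewrite !inE eqxx orbT.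
    have := pr (t e1); rewrite (negbTE bf) te.
    by case: (t e1 \in ends g).
  have [c fc] : exists c, ends f = [set s e1; c]%SET.
    by move: af; rewrite !inE => /orP[] /eqP ->; [exists (t f) | exists (s f); rewrite finset.setUC].
  have [c' gc] : exists c, ends g = [set t e1; c]%SET.
    by move: bg; rewrite !inE => /orP[] /eqP ->; [exists (t g) | exists (s g); rewrite finset.setUC].
  suff cc : c = c' by subst c'; apply: (tri_aux e1S fS gS _ fc gc).
  have [_ _ ac _] := meet_ends fS fc; have [_ _ bc _] := meet_ends gS gc.
  have cf : c \in ends f by rewrite fc !inE eqxx orbT.
  have ce1 : c \notin ends e1.
    rewrite !inE negb_or eq_sym ac /=; apply: contra bf => /eqP <-; exact: cf.
  have := pr c; rewrite (negbTE ce1) cf gc !inE.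
  move: ce1; rewrite !inE negb_or => /andP[_ /negbTE ->] /=.
  by case: eqP.
have all1 : cl e1 = cl e2 /\ cl e1 = cl e3.
  have [a2|a2] := boolP (s e1 \in ends e2).
    exact: (key e2 e3 (inS _ e1z) (inS _ m2) (inS _ m3) e21 e31 e23 parE a2).
  have a3 : s e1 \in ends e3.
    by have := parE (s e1); rewrite (negbTE a2) !inE eqxx /= addn0; case: (_ || _).
  suff [? ?] : cl e1 = cl e3 /\ cl e1 = cl e2 by [].
  have e32 : e3 != e2 by rewrite eq_sym.
  have parE' v : ~~ odd ((v \in ends e1) + (v \in ends e3) + (v \in ends e2)).
    by rewrite addnAC.
  exact: (key e3 e2 (inS _ e1z) (inS _ m3) (inS _ m2) e31 e21 e32 parE' a3).
have alle e : e \in supp z -> cl e = cl e1.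
  move=> ezz; have [->//|ne] := eqVneq e e1.
  have : e \in supp z :\ e1 by rewrite in_setD1 ne.
  by rewrite ez !inE => /orP[] /eqP ->; rewrite -?(all1.1) -?(all1.2).
by move=> e e' /alle -> /alle ->.
Qed.

Let cls U := [set e in S | cl e == U]%SET.

Let cls_sub U : cls U \subset S.
Proof. by apply/fintype.subsetP => e; rewrite inE => /andP[]. Qed.

(** The bound [3v - 6] for planar graphs, with [v <= k + 2]: the vertices of the class carry
    distinct (k+1)-subsets of [U]. The cycle [z] makes the list of faces nonempty, as [face_count]
    requires. *)
Let cls_edges U (z : chain) :
  cyc s t (cls U) z -> z != 0 -> (#|cls U| <= 3 * k)%N.
Proof.
move=> cz z0.
have cycS (y : chain) : cyc s t (cls U) y -> cyc s t S y.
  by case/andP=> ys y0; rewrite /cyc y0 (fintype.subset_trans ys (cls_sub U)).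
have girthU (y : chain) : cyc s t (cls U) y -> y != 0 -> (3 <= #|supp y|)%N.
  by move/cycS; exact: girth.
have [bs0 cnt0 sp0] := two_basis_sub (cls_sub U) planar.
have [bs [fr sp le]] := free_basis bs0.
have spE (y : chain) : (y \in <<bs>>%VS) = cyc s t (cls U) y by rewrite sp sp0.
have cnt e : (count (thru e) bs <= 2)%N by apply: leq_trans (le e) (cnt0 e).
have nn : bs != [::].
  apply: contra z0 => /eqP bs_nil; move: cz; rewrite -spE bs_nil span_nil memv0.
  by [].
have cy (b : chain) : b \in bs -> cyc s t (cls U) b by move=> bbs; rewrite -spE memv_span.
have fc := face_count fr nn cy cnt girthU.
have ge3 : (3 * size bs <= \sum_(b <- bs) #|supp b|)%N.
  rewrite -sum1_size big_distrr /= big_seq [leqRHS]big_seq; apply: leq_sum => b bbs.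
  by rewrite muln1; apply: girthU (cy _ bbs) (free_not0 fr bbs).
have [e0 e0z] : exists e, e \in supp z by apply/card_gt0P; apply: leq_trans (girthU z cz z0).
have e0U : e0 \in cls U by have /andP[/fintype.subsetP zU _] := cz; exact: zU.
have [e0S clU] : e0 \in S /\ cl e0 = U by move: e0U; rewrite inE => /andP[? /eqP].
pose WU := [set v in W | sg v \subset U]%SET.
have inWU e : e \in cls U -> (s e \in WU) && (t e \in WU).
  rewrite inE => /andP[eS /eqP eU]; have /andP[sW tW] := inW eS.
  by rewrite !inE sW tW -eU (@clE e (s e) (t e)) // finset.subsetUl finset.subsetUr.
have /andP[s0 _] := inWU _ e0U.
have sz := size_two_basis spE inWU s0.
suff : (#|WU| <= k.+2)%N by move: #|_| #|_| (size bs) sz fc ge3; lia.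
rewrite -(card_in_imset (f := sg)) => [|u v]; last first.
  by rewrite !inE => /andP[uW _] /andP[vW _]; exact: sg_inj.
rewrite -[leqRHS]binSn -(cl_card e0S) clU -cards_draws; apply: subset_leq_card.
apply/fintype.subsetP => _ /imsetP[v + ->]; rewrite !inE => /andP[vW ->] /=.
by rewrite sg_size.
Qed.

Let triangles (bs : seq chain) U :=
  count (fun b : chain => (#|supp b| == 3%N) && (supp b \subset cls U)) bs.

(** The triangles of a class form a free family of their own, and their sum acts as an outer face:
    [3T + 3 <= 2e]. Multiplied by [k], with [e <= 3k] from [cls_edges], this gives the claim. *)
Let triangles_class (bs : seq chain) U :
  free bs -> (forall z : chain, z \in bs -> cyc s t S z) ->
  (forall e, count (thru e) bs <= 2)%N ->
  (3 * k * triangles bs U <= (2 * k - 1) * #|cls U|)%N.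
Proof.
move=> fr cy cnt; rewrite /triangles -size_filter.
set p := (X in [seq x <- bs | X x]).
set r := [seq x <- bs | p x].
have [->|nn] := eqVneq r [::]; first by rewrite muln0.
have frr : free r by exact: filter_free.
have cyr (b : chain) : b \in r -> cyc s t (cls U) b.
  rewrite mem_filter => /andP[/andP[_ bU] /cy /andP[_ b0]].
  by rewrite /cyc bU.
have cntr e : (count (thru e) r <= 2)%N.
  by apply: leq_trans (cnt e); rewrite count_filter; apply: sub_count => b /andP[].
have girthU (y : chain) : cyc s t (cls U) y -> y != 0 -> (3 <= #|supp y|)%N.
  case/andP=> ys y0; apply: girth.
  by rewrite /cyc y0 (fintype.subset_trans ys (cls_sub U)).
have fc := face_count frr nn cyr cntr girthU.
have eq3 : (\sum_(b <- r) #|supp b| = 3 * size r)%N.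
  rewrite -sum1_size big_distrr /= big_seq [RHS]big_seq; apply: eq_bigr => b.
  by rewrite mem_filter => /andP[/andP[/eqP -> _] _].
have [b br] : exists b, b \in r by case: (r) nn => // b ? _; exists b; rewrite mem_head.
have b0 : b != 0.
  by move: frr => /free_not0; apply.
have := cls_edges (cyr b br) b0.
by move: fc; rewrite eq3; move: #|_| (size r); nia.
Qed.

Lemma edge_bound : ((4 * k + 1) * #|S| <= 12 * k * #|W|)%N.
Proof.
have [->|[e0 e0S]] := set_0Vmem S; first by rewrite cards0 muln0.
have [bs0 cnt0 sp0] := planar.
have [bs [fr sp le]] := free_basis bs0.
have spE (y : chain) : (y \in <<bs>>%VS) = cyc s t S y by rewrite sp sp0.
have cnt e : (count (thru e) bs <= 2)%N by apply: leq_trans (le e) (cnt0 e).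
have cy (b : chain) : b \in bs -> cyc s t S b by move=> bbs; rewrite -spE memv_span.
have /andP[s0 _] := inW e0S.
have sz := size_two_basis spE inW s0.
have total : (\sum_(b <- bs) #|supp b| <= 2 * #|S|)%N.
  have [->|nn] := eqVneq bs [::]; first by rewrite big_nil.
  by apply: leq_trans (face_count fr nn cy cnt girth); rewrite leq_addr.
(* Every face has four sides once each triangle is granted an extra unit, charged to the class of
   its edges. *)
have gt4 : (4 * size bs <= \sum_(b <- bs) #|supp b| + \sum_U triangles bs U)%N.
  have tE U : triangles bs U =
      (\sum_(b <- bs) ((#|supp b| == 3) && (supp b \subset cls U)))%N.
    rewrite /triangles -sum1_count big_mkcond; apply: eq_bigr => b _.
    by case: ifP.
  rewrite (eq_bigr _ (fun U _ => tE U)).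
  rewrite exchange_big -big_split /= -sum1_size big_distrr /= big_seq [leqRHS]big_seq.
  apply: leq_sum => b bbs; have cb := cy _ bbs.
  have := girth cb (free_not0 fr bbs); rewrite leq_eqVlt => /orP[/eqP b3|b4]; last first.
    by rewrite muln1 (leq_trans b4) ?leq_addr.
  have [e eb] : exists e, e \in supp b by apply/card_gt0P; rewrite -b3.
  rewrite -b3 muln1 -[4%N]/(3 + 1)%N leq_add2l (bigD1 (cl e)) //= (_ : _ \subset _) //.
  apply/fintype.subsetP => e' e'b; rewrite inE (tri_cl cb (esym b3) e'b eb) eqxx andbT.
  by have /andP[/fintype.subsetP/(_ _ e'b)] := cb.
have sumS : (\sum_U #|cls U| = #|S|)%N.
  rewrite -[RHS]sum1_card (partition_big cl xpredT) //=; apply: eq_bigr => U _.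
  by rewrite -sum1_card; apply: eq_bigl => e; rewrite inE.
have : (3 * k * \sum_U triangles bs U <= (2 * k - 1) * #|S|)%N.
  rewrite -sumS !big_distrr /=; apply: leq_sum => U _; exact: triangles_class.
move: gt4 total sz; set T3 := (\sum_U _)%N; set SS := (\sum_(b <- bs) _)%N.
move: T3 SS (size bs) #|S| #|W| => T3 SS F X Y h1 h2 h3 h4.
(* Euler's inequality and the count of sides eliminate the number [F] of faces. *)
have h5 : (2 * X <= 4 * Y + T3)%N by lia.
have h6 : (6 * k * X <= 12 * k * Y + 3 * k * T3)%N by nia.
have h7 : (6 * k * X <= 12 * k * Y + (2 * k - 1) * X)%N by lia.
by move: h7; rewrite mulnBl; nia.
Qed.

End EdgeBound.

(** * Contractions and the square grid *)

Definition adj (E V : finType) (s t : E -> V) : rel V :=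
  fun u v => [exists e, ((s e == u) && (t e == v)) || ((s e == v) && (t e == u))].

Section Contraction.
Variables (E V : finType) (s t : E -> V) (lam : V -> V).
Local Notation chain := {ffun E -> ('F_2)^o}.
Local Notation s' := (lam \o s).
Local Notation t' := (lam \o t).

Definition non_loops : {set E} := [set e | lam (s e) != lam (t e)]%SET.

(** Edges within a fibre become loops of the contracted graph. They contribute nothing to the
    boundary and are erased. *)
Definition restr (z : chain) : chain := [ffun e => if e \in non_loops then z e else 0].

Fact restr_is_linear : linear restr.
Proof.
move=> a y z; apply/ffunP => e; rewrite !ffunE; case: ifP => _ //.
by rewrite addr0 scaler0.
Qed.
HB.instance Definition _ := GRing.isLinear.Build _ _ _ _ restr restr_is_linear.

Lemma bd_restr z : bd s' t' (restr z) = bd s' t' z.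
Proof.
apply/ffunP => v; rewrite !ffunE; apply: eq_bigr => e _; rewrite ffunE inE /=.
by case: eqP => //= ->; rewrite F2_addxx !mulr0.
Qed.

Lemma bd_push z v : bd s' t' z v = \sum_(u | lam u == v) bd s t z u.
Proof.
under eq_bigr => u _ do rewrite ffunE.
rewrite ffunE exchange_big /=; apply: eq_bigr => e _.
rewrite -big_distrr /= big_split /=; congr (_ * (_ + _)).
  rewrite big_mkcond (bigD1 (s e)) //= big1 ?addr0 ?eqxx; first by case: eqP.
  by move=> u; rewrite eq_sym => /negbTE ->; case: ifP.
rewrite big_mkcond (bigD1 (t e)) //= big1 ?addr0 ?eqxx; first by case: eqP.
by move=> u; rewrite eq_sym => /negbTE ->; case: ifP.
Qed.

Let fiber_rel : rel V := [rel u v | (lam u == lam v) && adj s t u v].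

(** The chain of a path inside a fibre: all its edges become loops, so [restr] kills it. *)
Lemma fiber_chain u v : connect fiber_rel u v ->
  exists2 w : chain, restr w = 0 &
    forall x, bd s t w x = (u == x)%:R + (v == x)%:R.
Proof.
move=> /connectP[p]; elim: p u => [|u' p IH] u /= => [_ ->|].
  exists 0; first by rewrite linear0.
  by move=> x; rewrite linear0 ffunE F2_addxx.
case/andP=> /andP[/eqP luu' /existsP[e he]] pp lst.
have [w w0 bw] := IH _ pp lst.
exists ([ffun e' => (e' == e)%:R] + w).
  rewrite linearD /= w0 addr0; apply/ffunP => e'; rewrite !ffunE inE.
  case: (eqVneq e' e) => [->|_]; last by case: ifP.
  by case/orP: he => /andP[/eqP -> /eqP ->]; rewrite luu' eqxx.
move=> x; rewrite linearD /= ffunE bw ffunE (bigD1 e) //= big1 => [|e' ne]; last first.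
  by rewrite ffunE (negbTE ne) mul0r.
rewrite ffunE eqxx mul1r addr0.
have -> : (s e == x)%:R + (t e == x)%:R = (u == x)%:R + (u' == x)%:R :> 'F_2.
  by case/orP: he => /andP[/eqP -> /eqP ->] //; rewrite addrC.
by rewrite addrA -(addrA (u == x)%:R) F2_addxx addr0.
Qed.

(** Restricted generators stay cycles since boundaries push forward. Conversely, the boundary of a
    contracted cycle [z] in the original graph sums to 0 over each fibre; adding paths from [u] to
    [lam u] inside the fibres carries it to one point per fibre, where it cancels, so [z] lifts to a
    cycle. *)
Lemma two_basis_contract :
  (forall v, connect fiber_rel v (lam v)) ->
  two_basis s t [set: E]%SET -> two_basis s' t' non_loops.
Proof.
move=> conn [bs cnt sp].
exists (map restr bs).
  move=> e; rewrite count_map; apply: leq_trans (cnt e); apply: sub_count => b /=.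
  by rewrite /thru ffunE; case: ifP; rewrite ?eqxx.
pose f : 'Hom(chain, chain) := linfun restr.
have -> : map restr bs = map f bs by apply: eq_map => b; rewrite lfunE.
move=> z; rewrite -limg_span; apply/memv_imgP/idP => [[y + ->]|].
  rewrite sp lfunE /= => /andP[_ /eqP y0]; apply/andP; split.
    by apply/fintype.subsetP => e; rewrite inE ffunE; case: ifP; rewrite ?eqxx.
  rewrite bd_restr; apply/eqP/ffunP => v; rewrite bd_push ffunE big1 // => u _.
  by rewrite y0 ffunE.
case/andP=> zS /eqP z0.
have /choice[w wP] : forall u, exists w : chain, restr w = 0 /\
    forall x, bd s t w x = (u == x)%:R + (lam u == x)%:R.
  by move=> u; have [w w0 bw] := fiber_chain (conn u); exists w.
exists (z + \sum_u bd s t z u *: w u).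
  rewrite sp /cyc finset.subsetT /=; apply/eqP/ffunP => v.
  rewrite linearD linear_sum ffunE sum_ffunE.
  under eq_bigr => u _ do rewrite linearZ ffunE (wP u).2 scalerDr.
  rewrite big_split /= (bigD1 v) //= big1 => [|u ne]; last first.
    by rewrite (negbTE ne) scaler0.
  rewrite eqxx addr0 addrA -[X in _ + X + _]/(bd s t z v * 1) mulr1 F2_addxx add0r.
  have zv : bd s' t' z v = 0 by rewrite z0 ffunE.
  rewrite ffunE -[RHS]zv bd_push [RHS]big_mkcond; apply: eq_bigr => u _.
  by case: eqP => _; [exact: mulr1 | exact: mulr0].
rewrite lfunE /= linearD linear_sum big1 => [|u _]; last first.
  by rewrite linearZ /= (wP u).1 scaler0.
rewrite addr0; apply/ffunP => e; rewrite ffunE; case: ifP => // /negbT eS.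
by apply/eqP; apply: contraNT eS => ze; apply: (fintype.subsetP zS); rewrite inE.
Qed.

End Contraction.

(** * The cycle space of the square grid *)

Section Grid.
Variable m : nat.
Local Notation T := ('I_m.+1 * 'I_m.+1)%type.

(* The right and upper ends of the edges leaving the grid are all glued to the
   extra vertex [None], so that every unit square, including the incomplete ones
   along the border, bounds a cycle. *)
Definition gsrc (e : T * bool) : option T := Some e.1.
Definition gtgt (e : T * bool) : option T :=
  if e.2 then omap (fun i => (i, e.1.2)) (insub e.1.1.+1)
  else omap (fun j => (e.1.1, j)) (insub e.1.2.+1).

Local Notation chain := {ffun T * bool -> ('F_2)^o}.

(** The sides of the unit cell with lower left corner [q]; the flag [true] marks horizontal edges.
    Sides that would start outside the grid are missing. *)
Definition square (q : T) : chain := [ffun e : T * bool =>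
  (if e.2 then (q.1 == e.1.1 :> nat)%:R * ((q.2 == e.1.2 :> nat)%:R + (q.2.+1 == e.1.2 :> nat)%:R)
  else (q.2 == e.1.2 :> nat)%:R * ((q.1 == e.1.1 :> nat)%:R + (q.1.+1 == e.1.1 :> nat)%:R)) : 'F_2].

Let hz (z : chain) x y : 'F_2 := z ((inord x, inord y), true).
Let vz (z : chain) x y : 'F_2 := z ((inord x, inord y), false).

Lemma oppr_F2 (x : 'F_2) : - x = x.
Proof. by apply/eqP; rewrite eq_sym -addr_eq0 F2_addxx. Qed.

Lemma sum_delta (F : nat -> 'F_2) (c : nat) : (c <= m)%N ->
  \sum_(j < m.+1) F j * (j == c :> nat)%:R = F c.
Proof.
move=> cm; rewrite (bigD1 (inord c)) //= inordK // eqxx mulr1 big1 ?addr0 // => j ne.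
case: eqP => [jc|_]; last by rewrite mulr0.
by case/eqP: ne; apply: val_inj; rewrite /= inordK.
Qed.

Lemma sum_deltaS (F : nat -> 'F_2) (c : nat) : (c <= m)%N ->
  \sum_(j < m.+1) F j * (j.+1 == c :> nat)%:R = (0 < c)%:R * F c.-1.
Proof.
case: c => [_|c cm]; first by rewrite mul0r big1 // => j _; rewrite mulr0.
rewrite mul1r -(sum_delta F (ltnW cm)); apply: eq_bigr => j _.
by rewrite eqSS.
Qed.

Lemma sum_grid (F : T -> 'F_2) : \sum_p F p = \sum_i \sum_j F (i, j).
Proof. by rewrite pair_bigA; apply: eq_bigr => -[]. Qed.

Lemma gsrcE p h x y : (gsrc (p, h) == Some (x, y)) = (p.1 == x :> nat) && (p.2 == y :> nat).
Proof. by case: p => i j; rewrite /gsrc /= (inj_eq Some_inj). Qed.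

Lemma gtgtE p h (x y : 'I_m.+1) : (gtgt (p, h) == Some (x, y)) =
  if h then (p.1.+1 == x :> nat) && (p.2 == y :> nat)
  else (p.1 == x :> nat) && (p.2.+1 == y :> nat).
Proof.
case: p => i j; rewrite /gtgt /=; case: h; case: insubP => [k km kE|km] /=.
- by rewrite (inj_eq Some_inj) -kE.
- by apply/esym/negbTE; apply: contra km => /andP[/eqP -> _].
- by rewrite (inj_eq Some_inj) -kE.
- by apply/esym/negbTE; apply: contra km => /andP[_ /eqP ->].
Qed.

Lemma sum_grid_delta (F : nat -> nat -> 'F_2) (x y : 'I_m.+1) :
  \sum_(p : T) F p.1 p.2 * ((p.1 == x :> nat) && (p.2 == y :> nat))%:R = F x y.
Proof.
rewrite sum_grid -(sum_delta (fun i => F i y) (ltn_ord x : x <= m)%N).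
apply: eq_bigr => i _; rewrite -(sum_delta (F i) (ltn_ord y : y <= m)%N) big_distrl /=.
by apply: eq_bigr => j _; rewrite -mulrA -natrM mulnb andbC.
Qed.

Lemma bd_grid z (x y : 'I_m.+1) : bd gsrc gtgt z (Some (x, y)) =
  hz z x y + (0 < x)%:R * hz z x.-1 y + (vz z x y + (0 < y)%:R * vz z x y.-1).
Proof.
rewrite ffunE (eq_bigr (fun e : T * bool => (fun p h => z (p, h) *
  ((gsrc (p, h) == Some (x, y))%:R + (gtgt (p, h) == Some (x, y))%:R)) e.1 e.2)); last by case.
rewrite -(pair_bigA _ (fun p h => z (p, h) *
  ((gsrc (p, h) == Some (x, y))%:R + (gtgt (p, h) == Some (x, y))%:R))) /=.
under eq_bigr => p _ do rewrite big_bool /= !gsrcE !gtgtE !mulrDr.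
have zh (p : T) : z (p, true) = hz z p.1 p.2 by rewrite /hz !inord_val; case: p.
have zv (p : T) : z (p, false) = vz z p.1 p.2 by rewrite /vz !inord_val; case: p.
rewrite !big_split /=; congr (_ + _ + (_ + _)).
- under eq_bigr => p _ do rewrite zh.
  exact: sum_grid_delta.
- under eq_bigr => p _ do rewrite zh.
  rewrite sum_grid -(sum_deltaS (fun i => hz z i y) (ltn_ord x : x <= m)%N).
  apply: eq_bigr => i _; rewrite -(sum_delta (hz z i) (ltn_ord y : y <= m)%N) big_distrl /=.
  by apply: eq_bigr => j _; rewrite -mulrA -natrM mulnb andbC.
- under eq_bigr => p _ do rewrite zv.
  exact: sum_grid_delta.
- under eq_bigr => p _ do rewrite zv.
  rewrite sum_grid -(sum_delta (fun i => _ * vz z i _) (ltn_ord x : x <= m)%N).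
  apply: eq_bigr => i _; rewrite -(sum_deltaS (vz z i) (ltn_ord y : y <= m)%N) big_distrl /=.
  by apply: eq_bigr => j _; rewrite -mulrA -natrM mulnb andbC.
Qed.

(** Determines the boundary at the extra vertex [None] from that at the grid points. *)
Lemma sum_bd (E V : finType) (s t : E -> V) (z : {ffun E -> ('F_2)^o}) :
  \sum_v bd s t z v = 0.
Proof.
under eq_bigr => v _ do rewrite ffunE.
rewrite exchange_big big1 // => e _; rewrite -big_distrr /= big_split /=.
rewrite (bigD1 (s e)) //= eqxx big1 => [|v]; last by rewrite eq_sym => /negbTE ->.
rewrite (bigD1 (t e)) //= eqxx big1 => [|v]; last by rewrite eq_sym => /negbTE ->.
by rewrite !addr0 F2_addxx mulr0.
Qed.

Lemma square_cycle q : bd gsrc gtgt (square q) = 0.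
Proof.
have bS p : bd gsrc gtgt (square q) (Some p) = 0.
  case: p q => x y [i j]; rewrite bd_grid /hz /vz !ffunE /= !inord_val.
  have xm : (x.-1 < m.+1)%N by rewrite (leq_ltn_trans (leq_pred x)).
  have ym : (y.-1 < m.+1)%N by rewrite (leq_ltn_trans (leq_pred y)).
  rewrite !inordK //; move: (nat_of_ord x) (nat_of_ord y) (nat_of_ord i) (nat_of_ord j).
  move=> {}x {}y {}i {}j {xm ym}; case: x y => [|x] [|y] /=; rewrite ?eqSS.
  - by case: (i == 0)%N; case: (j == 0)%N; apply: val_inj.
  - by case: (i == 0)%N; case: (j == y)%N; case: (j == y.+1)%N; apply: val_inj.
  - by case: (i == x)%N; case: (i == x.+1)%N; case: (j == 0)%N; apply: val_inj.
  - by case: (i == x)%N; case: (i == x.+1)%N; case: (j == y)%N; case: (j == y.+1)%N; apply: val_inj.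
apply/ffunP => -[p|]; rewrite [RHS]ffunE //.
by have := sum_bd gsrc gtgt (square q); rewrite (bigD1 None) //= big1 ?addr0 // => -[p|] //.
Qed.

(** Adding up the vertex conditions at [(x, 0)], ..., [(x, y)] cancels every vertical edge except
    the one leaving [(x, y)] upwards. *)
Lemma grid_fill z (x y : nat) : (forall p, bd gsrc gtgt z (Some p) = 0) ->
  (x <= m)%N -> (y <= m)%N ->
  \sum_(0 <= b < y.+1) (hz z x b + (0 < x)%:R * hz z x.-1 b) = vz z x y.
Proof.
move=> z0 xm; elim: y => [|y IH] ym.
  have := z0 (Ordinal (xm : x < m.+1)%N, Ordinal (ym : 0 < m.+1)%N).
  rewrite bd_grid /= mul0r addr0 big_nat1 => /eqP; rewrite addr_eq0 => /eqP ->.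
  by rewrite oppr_F2.
rewrite big_nat_recr //= IH ?(ltnW ym) //.
have := z0 (Ordinal (xm : x < m.+1)%N, Ordinal (ym : y.+1 < m.+1)%N).
rewrite bd_grid /= mul1r => /eqP; rewrite addr_eq0 => /eqP ->.
rewrite oppr_F2 addrCA F2_addxx addr0 //.
Qed.

Lemma grid_two_basis : two_basis gsrc gtgt [set: T * bool]%SET.
Proof.
pose X : seq chain := [seq square q | q <- enum {: T}].
exists X.
  move=> e; rewrite count_map.
  have [p [p' pp]] : exists p p' : T, forall q, thru e (square q) -> q \in [set p; p']%SET.
    case: e => -[a c] h; exists (a, c).
    (* The cells on both sides of the edge. On the lower or left border the predecessor of 0 is 0,
       and the two choices coincide. *)
    exists (if h then (a, inord c.-1) else (inord a.-1, c)) => -[i j].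
    have cm : (c.-1 < m.+1)%N by rewrite (leq_ltn_trans (leq_pred c)).
    have am : (a.-1 < m.+1)%N by rewrite (leq_ltn_trans (leq_pred a)).
    case: h; rewrite /thru ffunE !inE /= !xpair_eqE -![i == _]val_eqE -![j == _]val_eqE /= inordK //.
      have [_|_] := eqVneq (nat_of_ord i) a; last by rewrite mul0r eqxx.
      have [//|_] := eqVneq (nat_of_ord j) c; rewrite mul1r add0r /=.
      by have [<-|_] := eqVneq j.+1 (nat_of_ord c); rewrite eqxx.
    have [_|_] := eqVneq (nat_of_ord j) c; last by rewrite mul0r eqxx.
    have [//|_] := eqVneq (nat_of_ord i) a; rewrite mul1r add0r /= andbT.
    by have [<-|_] := eqVneq i.+1 (nat_of_ord a); rewrite eqxx.
  have -> : count (preim square (thru e)) (enum {: T}) =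
      #|[set q | thru e (square q)]%SET|.
    rewrite cardE [in RHS]/enum_mem size_filter -enumT.
    by apply: eq_count => q; rewrite /= inE.
  apply: leq_trans (_ : #|[set p; p']%SET| <= 2)%N; last by rewrite cards2; case: eqP.
  by apply/subset_leq_card/fintype.subsetP => q; rewrite inE => /pp.
move=> z; apply/idP/idP => [zs|].
  have sub : (<<X>> <= lker (linfun (bd gsrc gtgt)))%VS.
    by apply/span_subvP => _ /mapP[q _ ->]; rewrite memv_ker lfunE /= square_cycle.
  rewrite /cyc finset.subsetT /=; have := subvP sub _ zs.
  by rewrite memv_ker lfunE.
rewrite /cyc => /andP[_ /eqP z0].
(* A ray going down from the cell [q] crosses [z] in [phi q] edges modulo 2, so [phi q] tells
   whether [q] is inside [z]; and [z] is the sum of the cells inside it. *)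
pose phi (q : T) := \sum_(0 <= b < q.2.+1) hz z q.1 b.
have -> : z = \sum_q phi q *: square q.
  apply/ffunP => -[[a c] h]; rewrite sum_ffunE.
  have am : (a <= m)%N := ltn_ord a.
  have cm : (c <= m)%N := ltn_ord c.
  pose F (x y : nat) := \sum_(0 <= b < y.+1) hz z x b.
  case: h.
    transitivity (F a c + (0 < c)%:R * F a c.-1).
      rewrite -[in LHS](inord_val a) -[in LHS](inord_val c) -[LHS]/(hz z a c) /F.
      case: (nat_of_ord c) => [|y] /=; first by rewrite mul0r addr0 big_nat1.
      by rewrite mul1r big_nat_recr //= addrAC F2_addxx add0r.
    rewrite -(sum_delta (fun i => F i c + (0 < c)%:R * F i c.-1) am) sum_grid.
    apply: eq_bigr => i _.
    rewrite -(sum_delta (F i) cm) -(sum_deltaS (F i) cm) -big_split big_distrl /=.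
    apply: eq_bigr => j _; rewrite !ffunE /= /phi /F.
    by rewrite -mulrDr -mulrA [_ * (i == a :> nat)%:R]mulrC.
  transitivity (F a c + (0 < a)%:R * F a.-1 c).
    have z1 p : bd gsrc gtgt z (Some p) = 0 by rewrite z0 ffunE.
    by rewrite /F big_distrr /= -big_split /= grid_fill // /vz !inord_val.
  rewrite -(sum_delta (fun j => F a j + (0 < a)%:R * F a.-1 j) cm) sum_grid exchange_big /=.
  apply: eq_bigr => j _.
  rewrite -(sum_delta (F^~ j) am) -(sum_deltaS (F^~ j) am) -big_split big_distrl /=.
  apply: eq_bigr => i _; rewrite !ffunE /= /phi /F.
  by rewrite -mulrDr -mulrA [_ * (j == c :> nat)%:R]mulrC.
apply: memv_suml => q _; apply: memvZ; apply: memv_span; apply: map_f.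
by rewrite mem_enum inE.
Qed.

End Grid.

(** * Contracting the regions *)

Lemma connect_crossing (T : finType) (r : rel T) (S : {set T}) p y :
  connect r p y -> p \notin S -> y \in S ->
  exists q q', [/\ r q q', q \notin S & q' \in S].
Proof.
move=> /connectP[w]; elim: w p => [|p' w IH] p /=; first by move=> _ -> /negbTE ->.
case/andP=> rp pw yE pS yS; have [p'S|p'S] := boolP (p' \in S).
  by exists p, p'.
exact: IH pw yE p'S yS.
Qed.

(** Breadth-first search: [rk] is the distance from the root, [par] the predecessor on a shortest
    path. The strict decrease of [rk] is the form in which acyclicity is used later. *)
Lemma distance_tree (T : finType) (r : rel T) (root : T) :
  exists (rk : T -> nat) (par : T -> T), forall c, connect r root c -> c != root ->
    r (par c) c /\ (rk (par c) < rk c)%N.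
Proof.
have /choice[rk rkP] : forall c, exists n, connect r root c ->
    (exists p, [/\ path r root p, last root p = c & size p = n]) /\
    (forall p, path r root p -> last root p = c -> (n <= size p)%N).
  move=> c; have [/connectP[p0 pp0 l0]|_] := boolP (connect r root c); last by exists 0%N.
  pose P n := `[< exists p, [/\ path r root p, last root p = c & size p = n] >].
  have exP : exists n, P n by exists (size p0); apply/asboolP; exists p0.
  case: (ex_minnP exP) => n /asboolP nP nmin; exists n => _; split=> // p pp lp.
  by apply: nmin; apply/asboolP; exists p.
have /choice[par parP] : forall c, exists c', connect r root c -> c != root ->
    r c' c /\ (rk c' < rk c)%N.
  move=> c; have [cc|_] := boolP (connect r root c); last by exists c.
  have [[p [pp lp sp]] _] := rkP c cc.
  case/lastP: p pp lp sp => [_ /= <- _|p y]; first by exists root; rewrite eqxx.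
  rewrite rcons_path last_rcons size_rcons => /andP[pp ry] yc sp; subst y.
  exists (last root p) => _ _; split=> //; rewrite -sp ltnS.
  have cl : connect r root (last root p) by apply/connectP; exists p.
  exact: (rkP _ cl).2.
by exists rk, par => c cc ne; apply: parP.
Qed.

Section Labelling.
Variables (E V C J : finType) (s t : E -> V).
Variables (U : C -> {set V}) (W : J -> {set V}) (x : C -> V) (inc : J -> pred C).
Local Notation adj := (adj s t).
Let within (A : {set V}) : rel V := [rel u v | [&& u \in A, v \in A & adj u v]].

Hypothesis xU : forall c, x c \in U c.
Hypothesis U_conn : forall c p, p \in U c -> connect (within (U c)) p (x c).
Hypothesis U_disj : forall c c' p, p \in U c -> p \in U c' -> c = c'.
Hypothesis xW : forall j c, inc j c -> x c \in W j.
Hypothesis W_conn : forall j p q, p \in W j -> q \in W j -> connect (within (W j)) p q.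
Hypothesis inc_ex : forall j, exists c, inc j c.
Hypothesis W_cross : forall j j' p, j != j' -> p \in W j -> p \in W j' ->
  exists c, p \in U c.
Hypothesis W_inc : forall j c p, p \in W j -> p \in U c -> inc j c.

Let x_inj : injective x.
Proof. by move=> c c' xx; apply: (U_disj (xU c)); rewrite xx. Qed.

Let lrel (S : {set V}) (l : V -> V) : rel V :=
  [rel u v | [&& u \in S, v \in S, l u == l v & adj u v]].

(** A contraction in progress. Fibres inside [S] are connected, and a point of [W j] may only take
    the label of a region incident to [j], so that the image of [W j] visits no other vertex. *)
Let labelled (S : {set V}) (l : V -> V) :=
  [/\ forall c, U c \subset S, forall c p, p \in U c -> l p = x c,
      forall p, p \in S -> connect (lrel S l) p (l p) &
      forall j p, p \in S -> p \in W j -> exists2 c, inc j c & l p = x c].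

Let labelled_init : exists S l, labelled S l.
Proof.
pose l p := if [pick c | p \in U c] is Some c then x c else p.
have lU c p : p \in U c -> l p = x c.
  rewrite /l => pc; case: pickP => [c' pc'|/(_ c)]; last by rewrite pc.
  by rewrite (U_disj pc pc').
have inS c p : p \in U c -> p \in [set p | [exists c, p \in U c]]%SET.
  by move=> pc; rewrite inE; apply/existsP; exists c.
exists [set p | [exists c, p \in U c]]%SET, l; split=> //.
- by move=> c; apply/fintype.subsetP => p; exact: inS.
- move=> p; rewrite inE => /existsP[c pc]; rewrite (lU c) //.
  apply: connect_sub (U_conn pc) => u v /and3P[uc vc uv]; apply: connect1.
  by rewrite /lrel /= (inS c u) // (inS c v) // (lU c) // (lU c v) // eqxx.
- move=> j p; rewrite inE => /existsP[c pc] pj; exists c; last exact: lU.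
  exact: W_inc pj pc.
Qed.

(** An unlabelled point of [W j] next to a labelled point of [W j] takes over its label. No other
    [W j'] constrains this choice: a common point of the two lies in some [U c] and was labelled
    from the start. *)
Let labelled_all : exists S l, labelled S l /\ forall j, W j \subset S.
Proof.
have [S0 [l0]] := labelled_init.
have [m] := ubnP #|~: S0|; elim: m S0 l0 => // m IH S l mS lab.
have [/forallP all|] := boolP [forall j, W j \subset S]; first by exists S, l.
rewrite negb_forall => /existsP[j /fintype.subsetPn[p pj pS]].
have [US lU lconn lW] := lab.
have [c jc] := inc_ex j.
have xS : x c \in S by apply: (fintype.subsetP (US c)).
have [q [q' [/and3P[qj q'j qq'] qS q'S]]] := connect_crossing (W_conn pj (xW jc)) pS xS.
pose l' u := if u == q then l q' else l u.
have l'S u : u \in S -> l' u = l u by rewrite /l'; case: eqP => // -> /(negP qS).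
have subr u v : connect (lrel S l) u v -> connect (lrel (q |: S)%SET l') u v.
  apply: connect_sub => {}u {}v /and4P[uS vS luv uv]; apply: connect1.
  by rewrite /lrel /= !in_setU1 uS vS !orbT !l'S // luv.
apply: (IH (q |: S)%SET l').
  have : (#|~: (q |: S)| < #|~: S|)%N.
    apply: proper_card; rewrite properC; apply: properUr.
    by rewrite finset.sub1set.
  by move=> h; rewrite -ltnS; apply: leq_trans mS; rewrite ltnS.
split.
- by move=> c'; apply: fintype.subset_trans (US c') _; apply: finset.subsetUr.
- by move=> c' u uc; rewrite l'S; [exact: lU | exact: (fintype.subsetP (US c'))].
- move=> u; rewrite in_setU1 => /orP[/eqP ->|uS]; last by rewrite l'S //; apply: subr; exact: lconn.
  have l'q : l' q = l q' by rewrite /l' eqxx.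
  rewrite l'q; apply: connect_trans (subr _ _ (lconn _ q'S)); apply: connect1.
  by rewrite /lrel /= setU11 in_setU1 q'S orbT l'q l'S // eqxx.
- move=> j' u; rewrite in_setU1 => /orP[/eqP ->|uS]; last by rewrite l'S //; exact: lW.
  move=> qj'; have [jj'|ne] := eqVneq j j'.
    by rewrite /l' eqxx -jj'; exact: lW.
  have [c' qc'] := W_cross ne qj qj'.
  by have := fintype.subsetP (US c') _ qc'; rewrite (negbTE qS).
Qed.

(** Once every point of [W j] bears the label of an incident region, walks in [W j] become walks
    between these regions. They thus form a connected graph, from which a breadth-first tree is
    taken. *)
Lemma planar_trees : two_basis s t [set: E]%SET ->
  exists (lam : V -> V) (root : J -> C) (rk : J -> C -> nat) (par : J -> C -> C),
    [/\ two_basis (lam \o s) (lam \o t) (non_loops s t lam),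
        forall j, inc j (root j) &
        forall j c, inc j c -> c != root j ->
          [/\ inc j (par j c), (rk j (par j c) < rk j c)%N &
              exists e, [set lam (s e); lam (t e)]%SET = [set x c; x (par j c)]%SET]].
Proof.
move=> tb; have [S [l [[US lU lconn lW] WS]]] := labelled_all.
pose lam p := if p \in S then l p else p.
have lamW j p : p \in W j -> exists2 c, inc j c & lam p = x c.
  move=> pj; have pS := fintype.subsetP (WS j) _ pj.
  by rewrite /lam pS; exact: lW.
have lamx c : lam (x c) = x c.
  by rewrite /lam (fintype.subsetP (US c)) // (lU c).
have /choice[root rootP] := inc_ex.
pose has_ed c c' (e : E) := [set lam (s e); lam (t e)]%SET == [set x c; x c']%SET.
(* A step between equal labels gives a loop of [cr j], harmless since ranks drop strictly along tree
   edges. *)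
pose cr j : rel C := [rel c c' | [&& inc j c, inc j c' & [exists e, has_ed c' c e]]].
have cr_conn j c : inc j c -> connect (cr j) (root j) c.
  move=> jc; have := W_conn (xW (rootP j)) (xW jc).
  suff H p q c0 : connect (within (W j)) p q -> inc j c0 -> lam p = x c0 ->
      exists2 c', lam q = x c' & connect (cr j) c0 c'.
    move=> /H/(_ (rootP j))/(_ (lamx _))[c']; rewrite lamx => /x_inj <-.
    exact.
  move=> /connectP[w]; elim: w p c0 => [|p' w IH] p c0 /=.
    by move=> _ -> _ lp; exists c0.
  case/andP=> /and3P[pj p'j pp'] pw qE jc0 lp.
  have [c1 jc1 lp'] := lamW j p' p'j.
  have [c' lq c1c'] := IH p' c1 pw qE jc1 lp'.
  exists c' => //; apply: connect_trans c1c'; apply: connect1.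
  rewrite /cr /= jc0 jc1 /=; move/existsP: pp' => [e he]; apply/existsP; exists e.
  rewrite /has_ed; case/orP: he => /andP[/eqP -> /eqP ->]; rewrite lp lp' //.
  by rewrite finset.setUC.
have /choice[rk /choice[par rpP]] : forall j, exists rk par, forall c,
    connect (cr j) (root j) c -> c != root j -> cr j (par c) c /\ (rk (par c) < rk c)%N.
  by move=> j; exact: distance_tree.
exists lam, root, rk, par; split=> //.
  apply: two_basis_contract tb => p.
  have [pS|pS] := boolP (p \in S); last first.
    by have -> : lam p = p by rewrite /lam (negbTE pS).
  have -> : lam p = l p by rewrite /lam pS.
  apply: connect_sub (lconn p pS) => u v /and4P[uS vS luv uv]; apply: connect1.
  by rewrite /= /lam uS vS luv.
move=> j c jc ne; have [/and3P[pj _ /existsP[e /eqP he]] rlt] := rpP j c (cr_conn j c jc) ne.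
by split=> //; exists e.
Qed.

End Labelling.

(** * From walks in the integer lattice to a finite grid *)

Definition zadj (p q : int * int) : bool :=
  ((p.1 == q.1) && ((q.2 == p.2 + 1) || (p.2 == q.2 + 1))) ||
  ((p.2 == q.2) && ((q.1 == p.1 + 1) || (p.1 == q.1 + 1))).

Definition walk (P : int * int -> Prop) (p q : int * int) : Prop :=
  exists w : seq (int * int),
    [/\ path zadj p w, last p w = q & forall y, y \in p :: w -> P y].

Section Embedding.
Variable M : nat.

Definition in_box (p : int * int) : bool :=
  (- M%:Z <= p.1 <= M%:Z) && (- M%:Z <= p.2 <= M%:Z).

Definition emb (p : int * int) : option ('I_(2 * M).+1 * 'I_(2 * M).+1) :=
  Some (inord (absz (p.1 + M%:Z)), inord (absz (p.2 + M%:Z))).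

Lemma emb_inj : {in in_box &, injective emb}.
Proof.
move=> [a b] [c d]; rewrite !unfold_in /in_box /= => /andP[a1 b1] /andP[c1 d1].
case=> /(congr1 val) /= + /(congr1 val) /=; rewrite !inordK; try lia.
by move=> h1 h2; congr pair; lia.
Qed.

Lemma emb_adj p q : in_box p -> in_box q -> zadj p q -> adj (@gsrc (2 * M)) (@gtgt _) (emb p) (emb q).
Proof.
move: p q => [a b] [c d]; rewrite /in_box /zadj /= => /andP[a1 b1] /andP[c1 d1] h.
apply/existsP; case/orP: h => /andP[/eqP e /orP[] /eqP e'].
- exists ((inord (absz (a + M%:Z)), inord (absz (b + M%:Z))), false).
  by rewrite gsrcE gtgtE /= !inordK ?eqxx /=; lia.
- exists ((inord (absz (c + M%:Z)), inord (absz (d + M%:Z))), false).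
  by rewrite !gsrcE !gtgtE /= !inordK ?eqxx /=; lia.
- exists ((inord (absz (a + M%:Z)), inord (absz (b + M%:Z))), true).
  by rewrite gsrcE gtgtE /= !inordK ?eqxx /=; lia.
- exists ((inord (absz (c + M%:Z)), inord (absz (d + M%:Z))), true).
  by rewrite !gsrcE !gtgtE /= !inordK ?eqxx /=; lia.
Qed.

End Embedding.

Lemma in_box_ex (L : seq (int * int)) : exists M, forall p, p \in L -> in_box M p.
Proof.
elim: L => [|p L [M MP]]; first by exists 0%N.
exists (M + absz p.1 + absz p.2)%N => q; rewrite inE => /orP[/eqP ->|/MP].
  by rewrite /in_box; apply/andP; split; lia.
by rewrite /in_box => /andP[h1 h2]; apply/andP; split; lia.
Qed.

Section Lattice.
Variables (C J : finType) (inc : J -> pred C).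
Variables (B : C -> int * int -> Prop) (D : J -> int * int -> Prop).
Variables (x : C -> int * int) (W : J -> seq (int * int)).

Hypothesis xB : forall c, B c (x c).
Hypothesis B_disj : forall c c' p, B c p -> B c' p -> c = c'.
Hypothesis DB_inc : forall j c p, D j p -> B c p -> inc j c.
Hypothesis W_D : forall j p, p \in W j -> D j p.
Hypothesis x_W : forall j c, inc j c -> x c \in W j.
Hypothesis W_walk : forall j p q, p \in W j -> q \in W j -> walk (fun y => y \in W j) p q.
(** Stronger than [B c p]: the lattice points of [B c] need not be connected, so a walk to the base
    point is demanded. *)
Hypothesis W_cross : forall j j' p, j != j' -> p \in W j -> p \in W j' ->
  exists c, walk (B c) (x c) p.
Hypothesis inc_ex : forall j, exists c, inc j c.

(** Finitely many lattice points suffice: the lists [W j] and, for each [c], one walk inside [B c]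
    from [x c] to each point of these lists that can be so reached. They fit in a box, which embeds
    in a finite grid. *)
Lemma lattice_trees :
  exists (E V : finType) (s t : E -> V) (lam : V -> V) (v : C -> V) (root : J -> C)
      (rk : J -> C -> nat) (par : J -> C -> C),
    [/\ two_basis (lam \o s) (lam \o t) (non_loops s t lam), injective v,
        forall j, inc j (root j) &
        forall j c, inc j c -> c != root j ->
          [/\ inc j (par j c), (rk j (par j c) < rk j c)%N &
              exists e, [set lam (s e); lam (t e)]%SET = [set v c; v (par j c)]%SET]].
Proof.
have /choice[wk wkP] : forall cp : C * (int * int), exists w, walk (B cp.1) (x cp.1) cp.2 ->
    [/\ path zadj (x cp.1) w, last (x cp.1) w = cp.2 & forall y, y \in x cp.1 :: w -> B cp.1 y].
  move=> [c p]; have [[w wP]|nw] := pselect (walk (B c) (x c) p); last by exists [::].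
  by exists w.
pose allW := flatten [seq W j | j <- enum J].
pose U c := x c :: flatten [seq wk (c, p) | p <- allW & `[< walk (B c) (x c) p >]].
have UP c y : y \in U c -> y = x c \/ exists p, [/\ p \in allW, walk (B c) (x c) p & y \in wk (c, p)].
  rewrite inE => /orP[/eqP ->|/flattenP[l /mapP[p]]]; first by left.
  by rewrite mem_filter => /andP[/asboolP pw pa] -> yl; right; exists p.
have UB c y : y \in U c -> B c y.
  move/UP => [->//|[p [_ /(wkP (c, p)) [_ _ h] yw]]]; apply: h.
  by rewrite inE yw orbT.
have wkU c p : p \in allW -> walk (B c) (x c) p -> {subset x c :: wk (c, p) <= U c}.
  move=> pa pw y; rewrite inE => /orP[/eqP ->|yw]; first exact: mem_head.
  rewrite inE; apply/orP; right; apply/flattenP; exists (wk (c, p)) => //.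
  by apply/mapP; exists p; rewrite // mem_filter pa andbT; apply/asboolP.
have [M MP] := in_box_ex (allW ++ flatten [seq U c | c <- enum C]).
have WM j p : p \in W j -> in_box M p.
  move=> pj; apply: MP; rewrite mem_cat; apply/orP; left; apply/flattenP; exists (W j) => //.
  by apply: map_f; rewrite mem_enum.
have UM c p : p \in U c -> in_box M p.
  move=> pc; apply: MP; rewrite mem_cat; apply/orP; right; apply/flattenP; exists (U c) => //.
  by apply: map_f; rewrite mem_enum.
have WallW j p : p \in W j -> p \in allW.
  by move=> pj; apply/flattenP; exists (W j) => //; apply: map_f; rewrite mem_enum.
pose img (A : seq (int * int)) := [set v | v \in map (emb M) A]%SET.
have imgE A v : (v \in img A) = (v \in map (emb M) A) by rewrite inE.
pose within (A : {set option ('I_(2 * M).+1 * 'I_(2 * M).+1)}) :=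
  [rel u v | [&& u \in A, v \in A & adj (@gsrc (2 * M)) (@gtgt _) u v]].
have walk_connect A p w : (forall q, q \in A -> in_box M q) -> path zadj p w ->
    (forall y, y \in p :: w -> y \in A) ->
    connect (within (img A)) (emb M p) (emb M (last p w)).
  move=> AM; elim: w p => [|q w IH] p /= pw inA; first exact: connect0.
  case/andP: pw => pq pw.
  have pA : p \in A by apply: inA; exact: mem_head.
  have qA : q \in A by apply: inA; rewrite !inE eqxx orbT.
  apply: connect_trans (connect1 _) (IH q pw _) => [|y yw]; last first.
    by apply: inA; rewrite inE yw orbT.
  by rewrite /within /= !imgE !map_f //= emb_adj //; apply: AM.
have within_sym A : connect_sym (within A).
  apply: sym_connect_sym => u v; rewrite /= andbCA; congr [&& _, _ & _].
  by apply: eq_existsb => e; rewrite orbC.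
have [lam [root [rk [par [tb rP treeP]]]]] :
  exists (lam : _ -> _) (root : J -> C) (rk : J -> C -> nat) (par : J -> C -> C),
    [/\ two_basis (lam \o @gsrc (2 * M)) (lam \o @gtgt _) (non_loops (@gsrc _) (@gtgt _) lam),
        forall j, inc j (root j) &
        forall j c, inc j c -> c != root j ->
          [/\ inc j (par j c), (rk j (par j c) < rk j c)%N &
              exists e, [set lam (@gsrc (2 * M) e); lam (@gtgt _ e)]%SET =
                [set emb M (x c); emb M (x (par j c))]%SET]].
  apply: (@planar_trees _ _ C J _ _ (fun c => img (U c)) (fun j => img (W j)) (fun c => emb M (x c)) inc).
  - by move=> c; rewrite imgE map_f // mem_head.
  - move=> c v; rewrite imgE => /mapP[p pc ->].
    have [->|[p' [pa pw yw]]] := UP _ _ pc; first exact: connect0.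
    rewrite within_sym; have [pth _ _] := wkP (c, p') pw.
    have := wkU c p' pa pw; have := pth; case/splitPr: yw => w1 w2.
    rewrite -cat_rcons cat_path => /andP[pth1 _] sub; rewrite -(last_rcons (x c) w1 p).
    apply: (walk_connect (U c)) pth1 _ => [q /UM //|q qw].
    by apply: sub; rewrite -cat_cons mem_cat qw.
  - move=> c c' v; rewrite !imgE => /mapP[p pc ->] /mapP[p' pc' /emb_inj pp'].
    have ep : p = p' by apply: pp'; [exact: UM pc | exact: UM pc'].
    by subst p'; exact: B_disj (UB _ _ pc) (UB _ _ pc').
  - by move=> j c jc; rewrite imgE map_f // x_W.
  - move=> j v v'; rewrite !imgE => /mapP[p pj ->] /mapP[q qj ->].
    have [w [pw <- wW]] := W_walk pj qj.
    by apply: walk_connect => // y; exact: WM.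
  - exact: inc_ex.
  - move=> j j' v jj'; rewrite !imgE => /mapP[p pj ->] /mapP[p' pj' /emb_inj pp'].
    have ep : p = p' by apply: pp'; [exact: WM pj | exact: WM pj'].
    subst p'; have [c cw] := W_cross jj' pj pj'.
    exists c; rewrite imgE map_f //; have [_ lst _] := wkP (c, p) cw.
    by apply: (wkU _ _ (WallW _ _ pj) cw); rewrite -[X in X \in _]lst mem_last.
  - move=> j c v; rewrite !imgE => /mapP[p pj ->] /mapP[p' pc /emb_inj pp'].
    have ep : p = p' by apply: pp'; [exact: WM pj | exact: UM pc].
    by subst p'; apply: DB_inc (W_D pj) (UB _ _ pc).
  - exact: grid_two_basis.
exists _, _, (@gsrc (2 * M)), (@gtgt (2 * M)), lam, (fun c => emb M (x c)), root, rk, par.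
have xM c : in_box M (x c) by apply: (@UM c); exact: mem_head.
split=> // c c' /emb_inj h; apply: (B_disj (xB c)).
by rewrite (h (xM c) (xM c')); exact: xB.
Qed.

End Lattice.

(** * Rounding paths to a grid *)

Local Open Scope classical_set_scope.

Lemma walk_refl (P : int * int -> Prop) p : P p -> walk P p p.
Proof. by move=> Pp; exists [::]; split=> // y; rewrite inE => /eqP ->. Qed.

Lemma walk_trans (P : int * int -> Prop) p q r : walk P p q -> walk P q r -> walk P p r.
Proof.
move=> [w [pw lw wP]] [w' [pw' lw' wP']]; exists (w ++ w'); split.
- by rewrite cat_path pw lw.
- by rewrite last_cat lw.
- move=> y; rewrite -cat_cons mem_cat => /orP[/wP //|yw']; apply: wP'.
  by rewrite inE yw' orbT.
Qed.

Lemma zadj_sym : symmetric zadj.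
Proof.
by move=> [a b] [c d]; rewrite /zadj /=; apply/idP/idP; lia.
Qed.

Lemma walk_step (P : int * int -> Prop) p q : P p -> P q -> (p == q) || zadj p q -> walk P p q.
Proof.
move=> Pp Pq /orP[/eqP <-|pq]; first exact: walk_refl.
by exists [:: q]; split=> //=; rewrite ?pq // => y; rewrite !inE => /orP[] /eqP ->.
Qed.

Lemma walk_sym (P : int * int -> Prop) p q : walk P p q -> walk P q p.
Proof.
move=> [w [pw <- wP]]; elim: w p pw wP => [|p' w IH] p /=.
  by move=> _ wP; apply: walk_refl; apply: wP; exact: mem_head.
move=> /andP[pp' pw] wP; apply: (@walk_trans _ _ p').
  by apply: IH => // y yw; apply: wP; rewrite inE yw orbT.
apply: walk_step; try by apply: wP; rewrite !inE eqxx ?orbT.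
by rewrite zadj_sym pp' orbT.
Qed.

Lemma walk_sub (P Q : int * int -> Prop) p q : (forall y, P y -> Q y) -> walk P p q -> walk Q p q.
Proof. by move=> PQ [w [pw lw wP]]; exists w; split=> // y /wP /PQ. Qed.

Section Rounding.
Variable R : realType.
Local Notation plane := (R * R)%type.
Implicit Types (h : R) (p : int * int) (y : plane).

Definition pt h p : plane := (h * p.1%:~R, h * p.2%:~R).
Definition fl h y : int * int := (Num.floor (y.1 / h), Num.floor (y.2 / h)).

Lemma pt_fl h y : 0 < h -> `|(pt h (fl h y)).1 - y.1| <= h /\ `|(pt h (fl h y)).2 - y.2| <= h.
Proof.
move=> h0.
have key (a : R) : `|h * (Num.floor (a / h))%:~R - a| <= h.
  have /andP[h1 h2] := floor_itv (a / h).
  move: h1 h2; rewrite ler_pdivlMr // ltr_pdivrMr // intrD mulrDl mul1r => h1 h2.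
  by rewrite ler_norml; move: h1 h2; rewrite (mulrC h); lra.
by split; exact: key.
Qed.

Lemma fl_pt h p : 0 < h -> fl h (pt h p) = p.
Proof.
move=> h0; case: p => a b; rewrite /fl /pt /=.
by congr pair; rewrite mulrC mulrA mulVf ?mul1r ?intrKfloor // gt_eqF.
Qed.

Lemma floor_close h (a b : R) : 0 < h -> `|a - b| < h ->
  [\/ Num.floor (a / h) = Num.floor (b / h),
      Num.floor (a / h) = Num.floor (b / h) + 1 |
      Num.floor (b / h) = Num.floor (a / h) + 1].
Proof.
move=> h0; rewrite ltr_norml => /andP[ab1 ab2].
have {ab1} ab1 : b / h < a / h + 1.
  by rewrite ltr_pdivrMr // mulrDl mul1r divfK ?gt_eqF //; lra.
have {ab2} ab2 : a / h < b / h + 1.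
  by rewrite ltr_pdivrMr // mulrDl mul1r divfK ?gt_eqF //; lra.
have /andP[a1 a2] := floor_itv (a / h); have /andP[b1 b2] := floor_itv (b / h).
set m := Num.floor (a / h) in a1 a2 *; set n := Num.floor (b / h) in b1 b2 *.
have : m%:~R < (n + 2)%:~R :> R by move: b2; rewrite !intrD; lra.
have : n%:~R < (m + 2)%:~R :> R by move: a2; rewrite !intrD; lra.
rewrite !ltr_int => h1 h2.
have [e|[e|e]] : m = n \/ m = n + 1 \/ n = m + 1 by lia.
- by constructor 1.
- by constructor 2.
- by constructor 3.
Qed.

(** The factor 2 leaves room for the rounding error and for one small move along the path, as a
    corner of the walk combines coordinates of two rounded points. *)
Definition close h p y := `|(pt h p).1 - y.1| <= 2 * h /\ `|(pt h p).2 - y.2| <= 2 * h.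

Lemma near_continuous (g : R -> plane) (A : set R) (t e : R) :
  {within A, continuous g} -> 0 < e -> A t ->
  \forall u \near t, A u -> `|(g t).1 - (g u).1| < e /\ `|(g t).2 - (g u).2| < e.
Proof.
move=> /subspace_continuousP gc e0 At; have FF : Filter (within A (nbhs t)) by apply: within_filter.
have := @cvg_ball _ _ _ _ FF _ _ (gc t At) _ e0.
by rewrite near_withinE; apply: filterS => u uP /uP.
Qed.

(** The set of [t] whose rounded point is reachable from the start is nonempty, open and closed in
    [[0, 1]], because nearby points of the path round to lattice points at most two steps apart. *)
Lemma walk_path (g : R -> plane) h : {within `[0, 1], continuous g} -> 0 < h ->
  walk (fun p => exists2 t, 0 <= t <= 1 & close h p (g t)) (fl h (g 0)) (fl h (g 1)).
Proof.
move=> gc h0; set Q := fun p => _.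
pose A : set R := `[0, 1].
have AE t : A t = (0 <= t <= 1) by rewrite /A /= in_itv.
have Qfl t : 0 <= t <= 1 -> Q (fl h (g t)).
  move=> t01; exists t => //; have [h1 h2] := pt_fl (g t) h0.
  by split; lra.
have loc t : A t -> \forall u \near t, A u -> walk Q (fl h (g t)) (fl h (g u)).
  move=> At; have := near_continuous gc h0 At; apply: filterS => u tu Au.
  have [tu1 tu2] := tu Au; have [f1 f2] := (floor_close h0 tu1, floor_close h0 tu2).
  (* Both coordinates may change at once, so the walk turns at this corner. *)
  have Qm : Q ((fl h (g u)).1, (fl h (g t)).2).
    exists t; first by rewrite -AE.
    have [h1 _] := pt_fl (g u) h0; have [_ h2] := pt_fl (g t) h0.
    split=> /=; last by move: h2 => /=; lra.
    have := ler_distD (g u).1 (pt h (fl h (g u))).1 (g t).1.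
    by move: h1 tu1; rewrite (distrC (g t).1) /=; lra.
  apply: (@walk_trans _ _ ((fl h (g u)).1, (fl h (g t)).2)).
    apply: walk_step => //; first by apply: Qfl; rewrite -AE.
    by rewrite /zadj /fl /= -pair_eqE /pair_eq /= eqxx andbT;
      case: f1 => ->; rewrite !eqxx ?orbT.
  apply: walk_step => //; first by apply: Qfl; rewrite -AE.
  by rewrite /zadj /fl /= -pair_eqE /pair_eq /= eqxx /=;
    case: f2 => ->; rewrite !eqxx ?orbT.
pose B : set R := [set t | A t /\ walk Q (fl h (g 0)) (fl h (g t))].
have A0 : A 0 by rewrite AE lexx ler01.
have A1 : A 1 by rewrite AE lexx ler01.
suff BA : B = A by move: A1; rewrite -BA => -[].
have /(_ B) := @segment_connected R 0 1; apply.
- by exists 0; split=> //; apply: walk_refl; apply: Qfl; rewrite -AE.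
- exists (interior [set t | A t -> B t]); first exact: open_interior.
  apply/seteqP; split=> t.
    move=> [At wt]; split=> //; have := loc t At; apply: filterS => u tu Au.
    by split=> //; exact: walk_trans wt (tu Au).
  by move=> [At /nbhs_singleton]; apply.
- exists (~` interior [set t | A t -> ~ B t]).
    by apply: open_closedC; exact: open_interior.
  apply/seteqP; split=> t.
    by move=> [At wt]; split=> // /nbhs_singleton /(_ At); apply.
  move=> [At nt]; apply: contrapT => nB; apply: nt.
  have := loc t At; apply: filterS => u tu Au [_ wu]; apply: nB; split=> //.
  exact: walk_trans wu (walk_sym (tu Au)).
Qed.

End Rounding.

(** * Compactness and the choice of a scale *)

Section Realization.
Variable R : realType.
Local Notation plane := (R * R)%type.

Lemma near_right0 (P : R -> Prop) (e : R) :
  0 < e -> (forall h, 0 < h < e -> P h) -> \forall h \near 0^'+, P h.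
Proof.
move=> e0 eP; near=> h; apply: eP; apply/andP; split; near: h.
  exact: nbhs_right_gt.
exact: nbhs_right_lt.
Unshelve. all: by end_near.
Qed.

Lemma open_box (B : set plane) y : open B -> B y ->
  exists2 e, 0 < e & forall z : plane, `|y.1 - z.1| < e -> `|y.2 - z.2| < e -> B z.
Proof.
move=> oB By; have /nbhs_ballP[e /= e0 eB] := open_nbhs_nbhs (conj oB By).
by exists e => // z z1 z2; apply: eB.
Qed.

(** Compactness of [[0, 1]] turns the local room around each [g t] into one threshold for the
    scale. *)
Lemma tube (B : set plane) (g : R -> plane) : open B ->
  {within `[0, 1], continuous g} -> (forall t, 0 <= t <= 1 -> B (g t)) ->
  \forall h \near 0^'+, forall p t, 0 <= t <= 1 -> close h p (g t) -> B (pt h p).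
Proof.
move=> oB gc gB.
have /compact_near_coveringP/near_covering_withinP := @segment_compact R 0 1.
move=> /(_ R 0^'+ (fun h t => forall p, close h p (g t) -> B (pt h p)) _) H.
have : \forall h \near 0^'+, `[0, 1] `<=` (fun t => forall p, close h p (g t) -> B (pt h p)).
  apply: H => t t01.
  have t01' : 0 <= t <= 1 by move: t01; rewrite /= in_itv.
  have [e e0 eB] := open_box oB (gB t t01').
  have e2 : 0 < e / 2 by lra.
  exists ([set u | `[0, 1] u -> `|(g t).1 - (g u).1| < e / 2 /\ `|(g t).2 - (g u).2| < e / 2],
          [set h | 2 * h < e / 2]).
    split=> /=; first exact: near_continuous.
    by apply: (@near_right0 _ (e / 4)) => [|h /andP[_ he]] /=; lra.
  move=> [u h] [/= ut he] u01 p [p1 p2]; have [u1 u2] := ut u01.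
  apply: eB; rewrite distrC.
    by have := ler_distD (g u).1 (pt h p).1 (g t).1; rewrite (distrC (g u).1); lra.
  by have := ler_distD (g u).2 (pt h p).2 (g t).2; rewrite (distrC (g u).2); lra.
by apply: filterS => h hP p t t01; apply: hP; rewrite /= in_itv.
Qed.

(** The walk rounds a path from [x] to [y], then the segment from [y] to [pt h p] within a box
    contained in [B]. The bound [e] is uniform in [h] and [p], which [crossing] needs. *)
Lemma open_walk (B : set plane) (x y : plane) : open B -> path_connected R B ->
  B x -> B y -> exists2 e, 0 < e & forall h, 0 < h < e -> forall p,
    `|y.1 - (pt h p).1| < e -> `|y.2 - (pt h p).2| < e ->
    walk (fun q => B (pt h q)) (fl h x) p.
Proof.
move=> oB pB Bx By.
have [e e0 eB] := open_box oB By.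
have [g [gc g0 g1 gB]] := pB x y Bx By.
have /nbhs_ballP[d /= d0 dP] := tube oB gc gB.
(* Below [d] the rounded path stays in [B]; below [e / 4] the distance to the segment and the error
   [2 * h] add up to less than [e]. *)
exists (Num.min d (e / 4)) => [|h /andP[h0]].
  by rewrite lt_min d0 /=; lra.
rewrite lt_min => /andP[hd he] p; rewrite !lt_min => /andP[_ p1] /andP[_ p2].
apply: (@walk_trans _ _ (fl h y)).
  rewrite -g0 -g1; apply: walk_sub (walk_path gc h0) => q [t t01 qt].
  apply: (dP h) qt => //=.
  by rewrite /ball /= sub0r normrN gtr0_norm.
pose z := pt h p; rewrite -/z in p1 p2.
pose s (t : R) : plane := (y.1 + t * (z.1 - y.1), y.2 + t * (z.2 - y.2)).
have s0 : s 0 = y by rewrite /s !mul0r !addr0; case: (y).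
have s1 : s 1 = z by rewrite /s !mul1r !subrKC; case: (z).
have sc : {within `[0, 1], continuous s}.
  have affine (a b : R) : continuous (fun t : R => a + t * b).
    move=> t; apply: cvgD; first exact: cvg_cst.
    by apply: cvgM; [exact: cvg_id|exact: cvg_cst].
  apply: continuous_subspaceT => t.
  exact: (@cvg_pair _ _ _ _ (nbhs (y.1 + t * (z.1 - y.1))) (nbhs (y.2 + t * (z.2 - y.2)))
    _ _ _ _ _ (affine _ _ t) (affine _ _ t)).
rewrite -[X in walk _ _ X](fl_pt p h0) -/z -s1 -[in fl h y]s0.
apply: walk_sub (walk_path sc h0) => q [t /andP[t0 t1] [q1 q2]].
have aux (a b c : R) : `|a - b| < e / 4 -> `|c - (a + t * (b - a))| <= 2 * h -> `|a - c| < e.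
  rewrite distrC => ab; have : `|t * (b - a)| <= `|b - a|.
    by rewrite normrM (ger0_norm t0) ler_piMl.
  move: (t * (b - a)) => u ub; have {ub ab} : `|u| < e / 4 by exact: le_lt_trans ub ab.
  rewrite !ltr_norml ler_norml => /andP[? ?] /andP[? ?].
  by apply/andP; split; lra.
by apply: eB; apply: aux; eassumption.
Qed.

(** Compactness of the square of parameters reduces this to a neighbourhood of one pair [(t, t')].
    If the paths meet there, the common point lies in some [B c] and [open_walk] applies; otherwise
    no lattice point of a fine grid is close to both. *)
Lemma crossing (C : Type) (B : C -> set plane) (x : C -> plane) (g g' : R -> plane) :
  (forall c, open (B c)) -> (forall c, path_connected R (B c)) -> (forall c, B c (x c)) ->
  {within `[0, 1], continuous g} -> {within `[0, 1], continuous g'} ->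
  (forall t t', 0 <= t <= 1 -> 0 <= t' <= 1 -> g t = g' t' -> exists c, B c (g t)) ->
  \forall h \near 0^'+, forall p t t', 0 <= t <= 1 -> 0 <= t' <= 1 ->
    close h p (g t) -> close h p (g' t') ->
    exists c, walk (fun q => B c (pt h q)) (fl h (x c)) p.
Proof.
move=> oB pB xB gc gc' meet.
have := compact_setX (@segment_compact R 0 1) (@segment_compact R 0 1).
move=> /compact_near_coveringP/near_covering_withinP.
pose P h (tt : R * R) := forall p, close h p (g tt.1) -> close h p (g' tt.2) ->
  exists c, walk (fun q => B c (pt h q)) (fl h (x c)) p.
move=> /(_ R 0^'+ P _) H.
have : \forall h \near 0^'+, `[0, 1] `*` `[0, 1] `<=` P h.
  apply: H => -[t t'] [/= t01 t01'].
  have inI (v : R) : v \in `[0, 1]%R -> 0 <= v <= 1 by rewrite in_itv.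
  suff [e e0 eP] : exists2 e, 0 < e & forall h u u', 0 < h < e ->
      `|(g t).1 - (g u).1| < e -> `|(g t).2 - (g u).2| < e ->
      `|(g' t').1 - (g' u').1| < e -> `|(g' t').2 - (g' u').2| < e -> P h (u, u').
    pose N (f : R -> plane) (v : R) :=
      [set u | `[0, 1] u -> `|(f v).1 - (f u).1| < e /\ `|(f v).2 - (f u).2| < e].
    exists (N g t `*` N g' t', [set h | 0 < h < e]).
      split=> /=; last exact: (@near_right0 _ e).
      by exists (N g t, N g' t') => //; split; exact: near_continuous.
    move=> [[u u'] h] [[/= ut ut'] he] [/= u01 u01'].
    by have [? ?] := ut u01; have [? ?] := ut' u01'; apply: eP.
  have [eqg|ne] := pselect (g t = g' t').
    have [c Bc] : exists c, B c (g t) by exact: (meet t t' (inI t t01) (inI t' t01')).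
    have [e e0 eP] := open_walk (oB c) (pB c) (xB c) Bc.
    exists (e / 4) => [|h u u' /andP[h0 he] u1 u2 _ _ p [p1 p2] _]; first by lra.
    exists c; apply: eP; first by rewrite h0; lra.
      by have := ler_distD (g u).1 (g t).1 (pt h p).1; rewrite (distrC (g u).1 (pt h p).1); lra.
    by have := ler_distD (g u).2 (g t).2 (pt h p).2; rewrite (distrC (g u).2 (pt h p).2); lra.
  pose d := Num.max `|(g t).1 - (g' t').1| `|(g t).2 - (g' t').2|.
  have d0 : 0 < d.
    rewrite lt_max !normr_gt0 !subr_eq0; apply: contrapT => /negP.
    rewrite negb_or !negbK => /andP[/eqP e1 /eqP e2]; apply: ne.
    by case: (g t) (g' t') e1 e2 => [? ?] [? ?] /= -> ->.
  (* Two deviations below [d / 8] and two rounding errors below [d / 4] add up to less than [d]. *)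
  exists (d / 8) => [|h u u' /andP[h0 he] u1 u2 v1 v2 p [p1 p2] [q1 q2]]; first by lra.
  have aux (a b a' b' c : R) : `|a - b| < d / 8 -> `|a' - b'| < d / 8 ->
      `|c - b| <= 2 * h -> `|c - b'| <= 2 * h -> `|a - a'| < d.
    by rewrite !ltr_norml !ler_norml => /andP[? ?] /andP[? ?] /andP[? ?] /andP[? ?];
      apply/andP; split; lra.
  have : d < d by rewrite {1}/d gt_max; apply/andP; split; apply: aux; eassumption.
  by rewrite ltxx.
by apply: filterS => h hP p t t' t01 t01'; apply: (hP (t, t')); split; rewrite /= in_itv.
Qed.

(** By finiteness of [J] and [C] a single scale [h] meets all conditions. Each [D j] is represented
    by rounded paths from one chosen region [r j] to the regions incident to [j]; these walks are
    connected through the base point of [r j]. *)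
Lemma planar_realization (C J : finType) (inc : J -> pred C)
    (B : C -> set plane) (D : J -> set plane) :
  (forall c, open (B c)) -> (forall c, path_connected R (B c)) -> (forall c, B c !=set0) ->
  (forall j, open (D j)) -> (forall j, path_connected R (D j)) ->
  (forall c c' p, B c p -> B c' p -> c = c') ->
  (forall j c, inc j c -> B c `<=` D j) ->
  (forall j c p, D j p -> B c p -> inc j c) ->
  (forall j j' p, j != j' -> D j p -> D j' p -> exists c, B c p) ->
  (forall j, exists c, inc j c) ->
  exists (E V : finType) (s t : E -> V) (lam : V -> V) (v : C -> V) (root : J -> C)
      (rk : J -> C -> nat) (par : J -> C -> C),
    [/\ two_basis (lam \o s) (lam \o t) (non_loops s t lam), injective v,
        forall j, inc j (root j) &
        forall j c, inc j c -> c != root j ->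
          [/\ inc j (par j c), (rk j (par j c) < rk j c)%N &
              exists e, [set lam (s e); lam (t e)]%SET = [set v c; v (par j c)]%SET]].
Proof.
move=> oB pB /choice[x xB] oD pD Bdisj BD DBinc Dmeet inc_ex.
have /choice[r rP] := inc_ex.
have /choice[g gP] : forall jc : J * C, exists g : R -> plane,
    [/\ {within `[0, 1], continuous g}, g 0 = x (r jc.1),
        inc jc.1 jc.2 -> g 1 = x jc.2 & forall t, 0 <= t <= 1 -> D jc.1 (g t)].
  (* For a pair that is not incident, a path from the base point of [r j] to itself serves as
     default. *)
  move=> [j c] /=; pose c' := if inc j c then c else r j.
  have jc' : inc j c' by rewrite /c'; case: ifP.
  have [g [gc g0 g1 gD]] := pD j _ _ (BD _ _ (rP j) _ (xB (r j))) (BD _ _ jc' _ (xB c')).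
  by exists g; split=> // jc; rewrite g1 /c' jc.
have near_D : \forall h \near 0^'+, forall jc p t, 0 <= t <= 1 ->
    close h p (g jc t) -> D jc.1 (pt h p).
  by apply: filter_forall => jc; have [gc _ _ gD] := gP jc; exact: tube.
have near_cross : \forall h \near 0^'+, forall jj : (J * C) * (J * C),
    jj.1.1 != jj.2.1 -> forall p t t', 0 <= t <= 1 -> 0 <= t' <= 1 ->
    close h p (g jj.1 t) -> close h p (g jj.2 t') ->
    exists c, walk (fun q => B c (pt h q)) (fl h (x c)) p.
  apply: filter_forall => -[jc jc'] /=.
  have [e|ne] := eqVneq jc.1 jc'.1; first by apply: nearW => h /eqP[].
  have [gc _ _ gD] := gP jc; have [gc' _ _ gD'] := gP jc'.
  have meet t t' : 0 <= t <= 1 -> 0 <= t' <= 1 -> g jc t = g jc' t' -> exists c, B c (g jc t).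
    by move=> t01 t01' e; apply: (Dmeet _ _ _ ne); [exact: gD | rewrite e; exact: gD'].
  by have := crossing oB pB xB gc gc' meet; apply: filterS => h hP _.
have near_B : \forall h \near 0^'+, forall c, B c (pt h (fl h (x c))).
  apply: filter_forall => c; have [e e0 eB] := open_box (oB c) (xB c).
  apply: (near_right0 e0) => h /andP[h0 he]; have [h1 h2] := pt_fl (x c) h0.
  by apply: eB; rewrite distrC; lra.
have near_pos : \forall h \near (0 : R)^'+, 0 < h by exact: nbhs_right_gt.
have FF : ProperFilter ((0 : R)^'+) by exact: at_right_proper_filter.
have [h [[[hD hcross] hB] h0]] :=
  @filter_ex _ _ FF _ (filterI (filterI (filterI near_D near_cross) near_B) near_pos).
pose Q jc p := exists2 t, 0 <= t <= 1 & close h p (g jc t).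
have /choice[w wP] : forall jc : J * C, exists w, [/\ path zadj (fl h (x (r jc.1))) w,
    inc jc.1 jc.2 -> last (fl h (x (r jc.1))) w = fl h (x jc.2) &
    forall y, y \in fl h (x (r jc.1)) :: w -> Q jc y].
  move=> jc; have [gc g0 g1 gD] := gP jc.
  have [w [pw lw wP]] := walk_path gc h0; rewrite g0 in pw lw wP.
  by exists w; split=> // /g1 <-.
pose W j := flatten [seq fl h (x (r j)) :: w (j, c) | c <- enum C].
have WP j p : p \in W j -> exists c, p \in fl h (x (r j)) :: w (j, c).
  by move=> /flattenP[l /mapP[c _ ->]]; exists c.
have inW j c : {subset fl h (x (r j)) :: w (j, c) <= W j}.
  move=> p pw; apply/flattenP; exists (fl h (x (r j)) :: w (j, c)) => //.
  by apply: map_f; rewrite mem_enum.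
have root_walk j p : p \in W j -> walk (fun y => y \in W j) (fl h (x (r j))) p.
  move=> /WP[c pc]; have [pth _ _] := wP (j, c); have sub := @inW j c.
  move: pc; rewrite inE => /orP[/eqP ->|pw].
    by apply: walk_refl; apply: sub; exact: mem_head.
  case/splitPr: pw pth sub => w1 w2.
  rewrite -cat_rcons cat_path => /andP[pw1 _] sub.
  exists (rcons w1 p); split=> //; first by rewrite last_rcons.
  by move=> y yw; apply: sub; rewrite -cat_cons mem_cat yw.
have WQ j p : p \in W j -> exists c, Q (j, c) p.
  by move=> /WP[c pw]; exists c; have [_ _] := wP (j, c); apply.
apply: (@lattice_trees C J inc (fun c p => B c (pt h p)) (fun j p => D j (pt h p))
  (fun c => fl h (x c)) W) => //.
- by move=> c c' p; exact: Bdisj.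
- by move=> j c p; exact: DBinc.
- by move=> j p /WQ[c [t t01 pt_t]]; exact: (hD (j, c)) pt_t.
- move=> j c jc; have [_ /(_ jc) <- _] := wP (j, c).
  by apply: (@inW j c); exact: mem_last.
- move=> j p q pj qj; apply: walk_trans (root_walk _ _ qj).
  by apply: walk_sym; exact: root_walk.
- move=> j j' p ne /WQ[c [t t01 ct]] /WQ[c' [t' t01' ct']].
  exact: (hcross ((j, c), (j', c')) ne p t t').
Qed.

End Realization.

(** * Counting *)

Lemma set2_eq (T : finType) (a b c d : T) :
  [set a; b]%SET = [set c; d]%SET -> (a = c /\ b = d) \/ (a = d /\ b = c).
Proof.
move=> /setP h; have := h a; have := h b; have := h c; have := h d.
rewrite !inE !eqxx !orbT /=.
do 4 ![move/esym/orP=> []/eqP ?|move/orP=> []/eqP ?]; subst; auto.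
Qed.

Section TreeBound.
Variables (n k : nat) (C J : finType) (sc : C -> {set 'I_n}) (sj : J -> {set 'I_n}).
Local Notation inc j c := (sj j \subset sc c).
Variables (E V : finType) (s t : E -> V) (v : C -> V) (root : J -> C).
Variables (rk : J -> C -> nat) (par : J -> C -> C) (S0 : {set E}).

Hypothesis k_ge2 : (2 <= k)%N.
Hypothesis sc_inj : injective sc.
Hypothesis sj_inj : injective sj.
Hypothesis sc_card : forall c, #|sc c| = k.+1.
Hypothesis sj_card : forall j, #|sj j| = k.
Hypothesis sj_all : forall c (B : {set 'I_n}), B \subset sc c -> #|B| = k -> exists j, sj j = B.
Hypothesis planar : two_basis s t S0.
Hypothesis S0P : forall e, (e \in S0) = (s e != t e).
Hypothesis v_inj : injective v.
Hypothesis tree : forall j c, inc j c -> c != root j ->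
  [/\ inc j (par j c), (rk j (par j c) < rk j c)%N &
      exists e, [set s e; t e]%SET = [set v c; v (par j c)]%SET].

Let P := [set jc : J * C | inc jc.1 jc.2 && (jc.2 != root jc.1)]%SET.

(** Every [c] contains [k + 1] sets [sj j]. Apart from one pair [(j, root j)] for each [j], the
    incidences are the elements of [P], each of which stands for a tree edge. *)
Let card_incidence : (k.+1 * #|C| <= #|P| + #|J|)%N.
Proof.
have le1 c : (k.+1 <= #|[set j | inc j c]%SET|)%N.
  rewrite -[X in (X <= _)%N]binSn -(sc_card c) -cards_draws.
  rewrite -(card_imset _ sj_inj); apply/subset_leq_card/fintype.subsetP => B.
  rewrite inE => /andP[Bc /eqP Bk]; have [j jB] := sj_all Bc Bk.
  by apply/imsetP; exists j; rewrite ?inE jB.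
have -> : (k.+1 * #|C| = \sum_(c : C) k.+1)%N by rewrite sum_nat_const mulnC.
apply: (@leq_trans (\sum_(c : C) #|[set j | inc j c]%SET|)%N).
  by apply: leq_sum => c _.
have -> : (\sum_(c : C) #|[set j | inc j c]%SET| = #|[set jc : J * C | inc jc.1 jc.2]%SET|)%N.
  rewrite -sum1_card (eq_bigl (fun jc : J * C => inc jc.1 jc.2)) => [|jc]; last by rewrite inE.
  rewrite -(pair_big_dep xpredT (fun j c => inc j c) (fun _ _ => 1%N)) /=.
  rewrite (exchange_big_dep xpredT) //=; apply: eq_bigr => c _.
  by rewrite -sum1_card; apply: eq_bigl => j; rewrite inE.
apply: leq_trans (subset_leq_card (_ : _ \subset P :|: [set (j, root j) | j : J])%SET) _.
  apply/fintype.subsetP => -[j c]; rewrite !inE /= => ->.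
  by have [->|_] := eqVneq c (root j); rewrite ?orbT //= imset_f ?orbT.
apply: leq_trans (leq_card_setU _ _) _; rewrite leq_add2l.
exact: leq_imset_card.
Qed.

Let par_neq j c : inc j c -> c != root j -> par j c != c.
Proof.
by move=> jc ne; have [_ + _] := tree jc ne; apply: contraTneq => ->; rewrite ltnn.
Qed.

(** Two regions adjacent in the tree of [j] determine [j], so different trees share no edge. *)
Let meetE j c c' : inc j c -> inc j c' -> c != c' -> sc c :&: sc c' = sj j.
Proof.
move=> jc jc' ne; apply/esym/eqP.
rewrite eqEcard finset.subsetI jc jc' sj_card /= -ltnS -(sc_card c).
apply: proper_card; rewrite finset.properEneq finset.subsetIl andbT.
apply: contra ne => /eqP/finset.setIidPl sub; apply/eqP/sc_inj/eqP.
by rewrite eqEcard sub !sc_card leqnn.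
Qed.

(** [edge_bound] is applied to the union of the trees. Edges with the same ends coincide: the ends
    determine [j], and the rank determines which of them is the child. *)
Lemma tree_bound : ((4 * k + 1) * (k.+1 * #|C|) <= (4 * k + 1) * #|J| + 12 * k * #|C|)%N.
Proof.
suff : ((4 * k + 1) * #|P| <= 12 * k * #|C|)%N.
  by move=> h; have := leq_mul (leqnn (4 * k + 1)%N) card_incidence; lia.
have [->|[[j0 c0]]] := set_0Vmem P; first by rewrite cards0 muln0.
rewrite inE /= => /andP[jc0 ne0]; have [_ _ [e0 _]] := tree jc0 ne0.
have /choice[ed edP] : forall jc, exists e, jc \in P ->
    [set s e; t e]%SET = [set v jc.2; v (par jc.1 jc.2)]%SET.
  move=> [j c]; have [|_] := boolP ((j, c) \in P); last by exists e0.
  by rewrite inE /= => /andP[jc ne]; have [_ _ [e he]] := tree jc ne; exists e.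
pose sg u := if [pick c | v c == u] is Some c then sc c else finset.set0.
have sgv c : sg (v c) = sc c.
  rewrite /sg; case: pickP => [c' /eqP/v_inj -> //|/(_ c)].
  by rewrite eqxx.
(* Arcs are oriented from child to parent; in a given tree a child has only one parent. *)
pose arc j e a b := exists c, [/\ (j, c) \in P, e = ed (j, c), a = v c & b = v (par j c)].
have arcE j e a b : arc j e a b -> [/\ [set s e; t e]%SET = [set a; b]%SET, a != b,
    sg a :&: sg b = sj j & exists ca cb, [/\ a = v ca, b = v cb & (rk j cb < rk j ca)%N]].
  move=> [c [jc -> -> ->]]; have ends := edP _ jc; move: jc; rewrite inE /= => /andP[jc ne].
  have [jp lt _] := tree jc ne; have pc := par_neq jc ne.
  split=> //; first by rewrite (inj_eq v_inj) eq_sym.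
    by rewrite !sgv; apply: meetE => //; rewrite eq_sym.
  by exists c, (par j c).
have arc_end j e a b c d : arc j e a b -> [set s e; t e]%SET = [set c; d]%SET ->
    arc j e c d \/ arc j e d c.
  move=> ab; have [-> _ _ _] := arcE _ _ _ _ ab.
  by move=> /set2_eq[] [<- <-]; [left | right].
have arc_child j e e' a b b' : arc j e a b -> arc j e' a b' -> e = e' /\ b = b'.
  by move=> [c [_ -> -> ->]] [c' [_ -> /v_inj <- ->]].
have arc_asym j e e' a b : arc j e a b -> arc j e' b a -> False.
  move=> /arcE[_ _ _ [a1 [b1 [-> -> lt]]]] /arcE[_ _ _ [b2 [a2 [/v_inj <- /v_inj <- lt']]]].
  by have := ltn_trans lt lt'; rewrite ltnn.
have arc_cycle j e e' e'' a b d : arc j e a b -> arc j e' b d -> arc j e'' d a -> False.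
  move=> /arcE[_ _ _ [a1 [b1 [-> -> lt]]]] /arcE[_ _ _ [b2 [d2 [/v_inj <- -> lt']]]].
  move=> /arcE[_ _ _ [d3 [a3 [/v_inj <- /v_inj <- lt'']]]].
  by have := ltn_trans lt'' (ltn_trans lt' lt); rewrite ltnn.
pose S := [set ed jc | jc in P]%SET.
have SE e : e \in S -> exists j a b, arc j e a b.
  by case/imsetP=> -[j c] jc ->; exists j, (v c), (v (par j c)), c.
pose W := [set v c | c : C]%SET.
have arcW j e a b : arc j e a b -> (a \in W) && (b \in W).
  by move=> [c [_ _ -> ->]]; rewrite !imset_f.
have arc_inj j j' e e' a b a' b' : arc j e a b -> arc j' e' a' b' ->
    [set a; b]%SET = [set a'; b']%SET -> [/\ e = e', j = j' & a = a'].
  move=> ab ab' eq2; have [_ _ m _] := arcE _ _ _ _ ab; have [_ _ m' _] := arcE _ _ _ _ ab'.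
  have jj : j = j'.
    by apply: sj_inj; rewrite -m -m'; case: (set2_eq eq2) => -[-> ->]; rewrite // finset.setIC.
  subst j'; case: (set2_eq eq2) => -[aa bb]; subst a' b'.
    by have [-> _] := arc_child _ _ _ _ _ _ ab ab'.
  by case: (arc_asym _ _ _ _ _ ab ab').
have cardS : #|S| = #|P|.
  apply: card_in_imset => -[j c] [j' c'] jc jc' ee.
  have a1 : arc j (ed (j, c)) (v c) (v (par j c)) by exists c.
  have a2 : arc j' (ed (j', c')) (v c') (v (par j' c')) by exists c'.
  have [|_ -> /v_inj -> //] := arc_inj _ _ _ _ _ _ _ _ a1 a2.
  by rewrite -(edP (j, c) jc) -(edP (j', c') jc') ee.
have cardW : #|W| = #|C| by rewrite card_imset.
rewrite -cardS -cardW; apply: (@edge_bound n k E V s t S W sg) => //.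
- move=> e /SE[j [a [b ab]]]; have /andP[aW bW] := arcW _ _ _ _ ab.
  have [ends _ _ _] := arcE _ _ _ _ ab.
  by case: (set2_eq ends) => -[-> ->]; rewrite aW bW.
- by move=> _ _ /imsetP[c _ ->] /imsetP[c' _ ->]; rewrite !sgv => /sc_inj ->.
- by move=> _ /imsetP[c _ ->]; rewrite sgv.
- move=> e /SE[j [a [b ab]]]; have [ends _ m _] := arcE _ _ _ _ ab.
  by case: (set2_eq ends) => -[-> ->]; [|rewrite finset.setIC]; rewrite m.
- move=> e e' /SE[j [a [b ab]]] /SE[j' [a' [b' ab']]] ee.
  have [ends _ _ _] := arcE _ _ _ _ ab; have [ends' _ _ _] := arcE _ _ _ _ ab'.
  have abE : [set a; b]%SET = [set a'; b']%SET by rewrite -ends -ends' ee.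
  by have [] := arc_inj _ _ _ _ _ _ _ _ ab ab' abE.
(* Equal meets put the three edges in one tree. Of the eight orientations, six give a vertex two
   parents, and two are directed cycles, along which the rank cannot keep decreasing. *)
- move=> a b d e1 e2 e3 ab ad bd /SE[j1 [a1 [b1 h1]]] /SE[j2 [a2 [b2 h2]]] /SE[j3 [a3 [b3 h3]]].
  move=> n1 n2 n3 [m1 m2].
  have sjE j e x y x' y' : arc j e x y -> [set s e; t e]%SET = [set x'; y']%SET -> sj j = sg x' :&: sg y'.
    move=> xy; have [-> _ <- _] := arcE _ _ _ _ xy.
    by move=> /set2_eq[] [-> ->]; rewrite // finset.setIC.
  have j12 : j2 = j1 by apply: sj_inj; rewrite (sjE _ _ _ _ _ _ h2 n2) (sjE _ _ _ _ _ _ h1 n1).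
  have j13 : j3 = j1 by apply: sj_inj; rewrite (sjE _ _ _ _ _ _ h3 n3) (sjE _ _ _ _ _ _ h1 n1).
  subst j2 j3.
  have [g1|g1] := arc_end _ _ _ _ _ _ h1 n1; have [g2|g2] := arc_end _ _ _ _ _ _ h2 n2;
    have [g3|g3] := arc_end _ _ _ _ _ _ h3 n3.
  all: try by have [_ h] := arc_child _ _ _ _ _ _ g1 g2; subst; rewrite eqxx in bd.
  all: try by have [_ h] := arc_child _ _ _ _ _ _ g1 g3; subst; rewrite eqxx in ad.
  all: try by have [_ h] := arc_child _ _ _ _ _ _ g2 g3; subst; rewrite eqxx in ab.
  + exact: arc_cycle g1 g3 g2.
  + exact: arc_cycle g1 g2 g3.
- apply: two_basis_sub planar; apply/fintype.subsetP => e /SE[j [a [b ab]]].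
  have [ends ne _ _] := arcE _ _ _ _ ab; rewrite S0P.
  by case: (set2_eq ends) => -[-> ->]; rewrite // eq_sym.
Qed.

End TreeBound.

(** * Open intersections, single points and the final count *)

Lemma open_not_singleton (R : realType) (x : R * R) : ~ open [set x].
Proof.
move=> /open_box/(_ (erefl x))[e e0 /(_ (x.1 + e / 2, x.2))] /=.
rewrite subrr normr0 => /(_ _ e0) h.
have : (x.1 + e / 2, x.2) = x.
  by apply: h; rewrite opprD addNKr normrN gtr0_norm; lra.
by case: x {h} => a b [] /= ?; lra.
Qed.

Section FaceCap.
Variables (n : nat) (T : Type) (A : 'I_n -> set T).

Lemma face_capU (s t : {set 'I_n}) :
  face_cap A (s :|: t)%SET = face_cap A s `&` face_cap A t.
Proof.
rewrite /face_cap -bigcap_setU; congr bigcap; apply/seteqP; split=> i /=.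
  by rewrite finset.in_setU => /orP[]; [left|right].
by rewrite finset.in_setU => -[] ->; rewrite ?orbT.
Qed.

Lemma face_capS (s t : {set 'I_n}) : s \subset t -> face_cap A t `<=` face_cap A s.
Proof. by move=> st p pt i /= /(fintype.subsetP st); exact: pt. Qed.

End FaceCap.

Lemma card_cup_diff (T : finType) (s t : {set T}) m :
  #|s| = m -> #|t| = m -> s != t -> (m.+1 <= #|s :|: t|)%N.
Proof.
move=> sm tm; apply: contraR; rewrite -leqNgt => le.
have st : s = (s :|: t)%SET by apply/eqP; rewrite eqEcard finset.subsetUl sm.
have ts : t = (s :|: t)%SET by apply/eqP; rewrite eqEcard finset.subsetUr tm.
by rewrite {1}st -ts.
Qed.

Theorem theorem2p1 (R : realType) (k n : nat) (A : 'I_n -> set (R * R)%type)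
  (hk : (2 <= k)%N)
  (hi : f_num A k.+1 = 0%N)
  (hii : forall s : {set 'I_n}, #|s| = k \/ #|s| = k.+1 ->
     [\/ face_cap A s = set0,
         exists x : R * R, face_cap A s = [set x] |
         open (face_cap A s) /\ path_connected R (face_cap A s)]) :
  (f_num A k)%:R <= c_bound R k * (f_ind A k.-1)%:R.
Proof.
have kpred : k.-1.+1 = k by rewrite prednK //; lia.
have big (s : {set 'I_n}) p : (k.+1 < #|s|)%N -> ~ face_cap A s p.
  move=> ks ps.
  have : (0 < #|[set B : {set 'I_n} | B \subset s & #|B| == k.+2]%SET|)%N.
    by rewrite cards_draws bin_gt0.
  move=> /card_gt0P[B]; rewrite inE => /andP[Bs Bk].
  move/eqP: hi; rewrite /f_num cards_eq0 => /eqP/setP/(_ B); rewrite !inE Bk andbT.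
  by move=> /asboolP; apply; exists p; apply: face_capS ps.
have trich (s : {set 'I_n}) p : #|s| = k \/ #|s| = k.+1 -> face_cap A s p ->
    face_cap A s = [set p] \/ open (face_cap A s).
  move=> sk ps; have [s0|[x sx]|[]] := hii s sk; [by rewrite s0 in ps| |by right].
  by left; move: ps; rewrite sx /= => ->.
have pathc (s : {set 'I_n}) p : #|s| = k \/ #|s| = k.+1 -> face_cap A s p ->
    open (face_cap A s) -> path_connected R (face_cap A s).
  move=> sk ps os; have [s0|[x sx]|[]//] := hii s sk; first by rewrite s0 in ps.
  by case: (@open_not_singleton R x); rewrite -sx.
pose N1 := [set s in nerve A | #|s| == k.+1]%SET.
pose isop (s : {set 'I_n}) := `[< open (face_cap A s) >].
pose Op := [set s in N1 | isop s]%SET.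
pose Si := [set s in N1 | ~~ isop s]%SET.
(* [Jo] indexes the trees: for [t] in it, [A_t] contains a nonempty open [A_s], so it is not a
   single point and is open. [X] collects the single-point [A_t] with [t] inside some [s] of
   [Si]. *)
pose Jo := [set t : {set 'I_n} | (#|t| == k) && [exists s in Op, t \subset s]]%SET.
pose Xs (s : {set 'I_n}) := [set t : {set 'I_n} | [&& t \subset s, #|t| == k & ~~ isop t]]%SET.
pose X := (\bigcup_(s in Si) Xs s)%SET.
pose T1 := [set t in nerve A | (#|t| == k.-1.+1) &&
      [exists s in nerve A, (t \subset s) && (#|s| == k.-1.+2)]]%SET.
have N1P s : reflect ((exists p, face_cap A s p) /\ #|s| = k.+1) (s \in N1).
  rewrite !inE; apply: (iffP andP) => -[h1 h2]; split; try exact/eqP.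
    by move/asboolP: h1.
  exact/asboolP.
have OpP s : s \in Op -> [/\ exists p, face_cap A s p, #|s| = k.+1 & open (face_cap A s)].
  by rewrite inE => /andP[/N1P[? ?] /asboolP ?].
have SiP s : s \in Si -> exists2 p, face_cap A s = [set p] & #|s| = k.+1.
  rewrite inE => /andP[/N1P[[p ps] sk] /asboolP nop]; exists p => //.
  by have [//|/nop] := trich s p (or_intror sk) ps.
have JoP t : t \in Jo -> [/\ exists p, face_cap A t p, #|t| = k,
    open (face_cap A t) & path_connected R (face_cap A t)].
  rewrite inE => /andP[/eqP tk /existsP[s /andP[sO ts]]].
  have [[p ps] sk os] := OpP s sO.
  have pt := face_capS ts ps.
  have ot : open (face_cap A t).
    have [tp|//] := trich t p (or_introl tk) pt.
    case: (@open_not_singleton R p); rewrite (_ : [set p] = face_cap A s) //.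
    by apply/seteqP; split=> [_ -> //|q qs]; have := face_capS ts qs; rewrite tp.
  by split=> //; [exists p | apply: (pathc t p) => //; left].
have cup_ge (s t : {set 'I_n}) p : face_cap A s p -> face_cap A t p -> (#|s :|: t| <= k.+1)%N.
  by move=> ps pt; rewrite leqNgt; apply/negP => /(big _ p); apply; rewrite face_capU.
have N1_disj (s s' : {set 'I_n}) p : #|s| = k.+1 -> #|s'| = k.+1 -> face_cap A s p -> face_cap A s' p -> s = s'.
  move=> sk sk' ps ps'; apply/eqP; apply: contraT => ne.
  by have := card_cup_diff sk sk' ne; rewrite ltnNge (cup_ge _ _ _ ps ps').
have main : ((4 * k + 1) * (k.+1 * #|Op|) <= (4 * k + 1) * #|Jo| + 12 * k * #|Op|)%N.
  pose C := {s | s \in Op}; pose J := {t | t \in Jo}.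
  have cC : #|{: C}| = #|Op| by rewrite card_sig.
  have cJ : #|{: J}| = #|Jo| by rewrite card_sig.
  rewrite -cC -cJ.
  pose inc (j : J) : pred C := fun c => val j \subset val c.
  have [||||||||||E [V [s [t [lam [v [root [rk [par [tb vinj rootP tree]]]]]]]]]] :=
    @planar_realization R C J inc (fun c => face_cap A (val c)) (fun j => face_cap A (val j)).
  - by move=> c; have [] := OpP _ (valP c).
  - by move=> c; have [[p pc] sk oc] := OpP _ (valP c); apply: (pathc _ p) => //; right.
  - by move=> c; have [] := OpP _ (valP c).
  - by move=> j; have [] := JoP _ (valP j).
  - by move=> j; have [] := JoP _ (valP j).
  - move=> c c' p pc pc'; apply: val_inj; have [_ ck _] := OpP _ (valP c).
    by have [_ ck' _] := OpP _ (valP c'); exact: N1_disj pc pc'.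
  - by move=> j c; exact: face_capS.
  - move=> j c p pj pc; have [_ ck _] := OpP _ (valP c).
    rewrite /inc; suff -> : val c = (val j :|: val c)%SET by rewrite finset.subsetUl.
    by apply/eqP; rewrite eqEcard finset.subsetUr ck (cup_ge _ _ _ pj pc).
  (* The union of the two sets has exactly [k + 1] elements, and its intersection is open as a meet
     of two open sets, so it is one of the regions. *)
  - move=> j j' p ne pj pj'; have [_ jk oj _] := JoP _ (valP j).
    have [_ jk' oj' _] := JoP _ (valP j').
    have pu : face_cap A (val j :|: val j')%SET p by rewrite face_capU.
    have uO : (val j :|: val j')%SET \in Op.
      rewrite inE; apply/andP; split; last by apply/asboolP; rewrite face_capU; exact: openI.
      apply/N1P; split; first by exists p.
      apply/eqP; rewrite eqn_leq (cup_ge _ _ _ pj pj') /=.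
      by apply: card_cup_diff => //; rewrite (inj_eq val_inj).
    by exists (exist (fun s => s \in Op) _ uO).
  - move=> j; have := valP j; rewrite inE => /andP[_ /existsP[s /andP[sO js]]].
    by exists (exist (fun s => s \in Op) s sO).
  apply: (@tree_bound n k C J val val E V (lam \o s) (lam \o t) v root rk par
    (non_loops s t lam)) => //.
  - by move=> c; have [] := OpP _ (valP c).
  - by move=> j; have [] := JoP _ (valP j).
  - move=> c B Bc Bk; have BJ : B \in Jo.
      by rewrite inE Bk eqxx; apply/existsP; exists (val c); rewrite Bc (valP c).
    by exists (exist (fun t => t \in Jo) B BJ).
  - by move=> e; rewrite inE.
(* If two distinct k-subsets of [s] had open intersections, their meet [A_s] would be open and not a
   point. So all but at most one of the [k + 1] subsets belong to [Xs s]. *)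
have Xs_card s : s \in Si -> (k <= #|Xs s|)%N.
  move=> sS; have [p sp sk] := SiP s sS.
  pose Os := [set t : {set 'I_n} | [&& t \subset s, #|t| == k & isop t]]%SET.
  have Os1 : (#|Os| <= 1)%N.
    apply/card_le1_eqP => t t'; rewrite !inE => /and3P[ts /eqP tk /asboolP ot].
    move=> /and3P[ts' /eqP tk' /asboolP ot']; apply/eqP; apply: contraT => ne.
    case: (@open_not_singleton R p); rewrite -sp.
    suff -> : s = (t :|: t')%SET by rewrite face_capU; exact: openI.
    apply/esym/eqP; rewrite eqEcard finset.subUset ts ts' sk /=.
    by apply: card_cup_diff; rewrite // eq_sym.
  have draws : (k.+1 <= #|(Xs s :|: Os)%SET|)%N.
    rewrite -[X in (X <= _)%N]binSn -sk -cards_draws; apply/subset_leq_card/fintype.subsetP => t.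
    by rewrite !inE => /andP[-> ->] /=; case: (isop t).
  by have := leq_trans draws (leq_card_setU _ _); lia.
(* For a common [t], [A_t] is one point, and both [A_s] and [A_s'] are that point; different [s],
   [s'] would put it in too many members of the family. *)
have Xs_disj s s' t : s \in Si -> s' \in Si -> t \in Xs s -> t \in Xs s' -> s = s'.
  move=> sS sS'; rewrite !inE => /and3P[ts /eqP tk /asboolP nt] /and3P[ts' _ _].
  have [p sp sk] := SiP s sS; have [p' sp' sk'] := SiP s' sS'.
  have ps : face_cap A s p by rewrite sp.
  have ps' : face_cap A s' p' by rewrite sp'.
  have [tp|//] := trich t p (or_introl tk) (face_capS ts ps).
  have pp : p' = p by have := face_capS ts' ps'; rewrite tp.
  by apply: N1_disj ps _ => //; rewrite -pp.
have X_card : (k * #|Si| <= #|X|)%N.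
  rewrite mulnC -sum_nat_const; apply: leq_trans (_ : \sum_(s in Si) #|Xs s| <= _)%N.
    by apply: leq_sum => s; exact: Xs_card.
  have -> : (\sum_(s in Si) #|Xs s| = \sum_(t : {set 'I_n}) \sum_(s in Si | t \in Xs s) 1)%N.
    rewrite (exchange_big_dep (mem Si)) //=; last by move=> t s _ /andP[].
    by apply: eq_bigr => s sS; rewrite -sum1_card; apply: eq_bigl => t; rewrite sS.
  rewrite -[leqRHS]sum1_card [leqRHS]big_mkcond; apply: leq_sum => t _.
  rewrite sum1_card; case: ifP => [_|/negbT tX].
    apply/card_le1_eqP => s s'; rewrite !unfold_in /= => /andP[sS ts] /andP[sS' ts'].
    exact: (Xs_disj _ _ _ sS' sS ts' ts).
  rewrite leqn0; apply/pred0P => s /=; apply/negP => /andP[sS ts].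
  by case/negP: tX; apply/finset.bigcupP; exists s.
have sub_T1 : (Jo :|: X)%SET \subset T1.
  have nerveP s p : face_cap A s p -> s \in nerve A by rewrite inE => ?; apply/asboolP; exists p.
  apply/fintype.subsetP => t; rewrite finset.in_setU => /orP[tJ|/finset.bigcupP[s sS]].
    have [[p pt] tk _ _] := JoP t tJ; move: tJ; rewrite [in X in X -> _]inE tk eqxx.
    move=> /existsP[s /andP[sO ts]]; have [[q qs] sk _] := OpP s sO.
    rewrite inE (nerveP t p pt) kpred tk eqxx /=; apply/existsP; exists s.
    by rewrite (nerveP s q qs) ts sk eqxx.
  rewrite [in X in X -> _]inE => /and3P[ts /eqP tk _]; have [p sp sk] := SiP s sS.
  have ps : face_cap A s p by rewrite sp.
  rewrite inE (nerveP t p (face_capS ts ps)) kpred tk eqxx /=; apply/existsP; exists s.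
  by rewrite (nerveP s p ps) ts sk eqxx.
have JX : (Jo :&: X)%SET = finset.set0.
  apply/setP => t; rewrite finset.in_set0 finset.in_setI; apply/negP => /andP[/JoP[_ _ ot _] /finset.bigcupP[s _]].
  by rewrite inE => /and3P[_ _ /asboolP].
have ind : (#|Jo| + k * #|Si| <= f_ind A k.-1)%N.
  apply: leq_trans (subset_leq_card sub_T1).
  by rewrite cardsU JX cards0 subn0 leq_add2l.
have num : (f_num A k = #|Op| + #|Si|)%N.
  have -> : Op = (N1 :&: [set s | isop s])%SET by apply/setP => s; rewrite !inE.
  have -> : Si = (N1 :\: [set s | isop s])%SET by apply/setP => s; rewrite !inE andbC.
  by rewrite cardsID.
rewrite num; move: #|Op| #|Si| #|Jo| (f_ind A k.-1) main ind => c s j f main ind.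
have {}main : ((4 * k + 1) * (k.+1 * c))%:R <= ((4 * k + 1) * j + 12 * k * c)%:R :> R by rewrite ler_nat.
have {}ind : (j + k * s)%:R <= f%:R :> R by rewrite ler_nat.
have k2 : 2 <= k%:R :> R by rewrite ler_nat.
(* The denominator is 3 at [k = 2] and grows with [k], so it is positive. *)
rewrite /c_bound mulrAC ler_pdivlMr; last by nra.
move: main ind; rewrite -(addn1 k) !(natrD, natrM).
have := ler0n R c; have := ler0n R s; have := ler0n R j.
move: (k%:R : R) (c%:R : R) (s%:R : R) (j%:R : R) (f%:R : R) k2 => K x y z w k2 z0 y0 x0 main ind.
(* The single points fit within the same constant: each contributes [K] to the bound on [w], and
   [4K^2 - 7K + 1 <= (4K + 1)K]. *)
have h1 : (4 * K + 1) * (z + K * y) <= (4 * K + 1) * w by rewrite ler_wpM2l //; lra.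
have h2 : 0 <= K * y by rewrite mulr_ge0 //; lra.
by nra.
Qed.
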